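(* Let $G$ be a finite unipotent group scheme over an algebraically closed field $k$ of characteristic $p>0$. For every positive integer $n$, there are only finitely many isomorphism classes of endotrivial $kG$-modules of dimension $n$.
   Context: $kG$ is the group algebra (dual of the coordinate algebra) of $G$, a finite-dimensional cocommutative Hopf algebra; $G$ is unipotent if $kG$ is local. A $kG$-module $M$ is endotrivial if $M^*\otimes_k M\cong k\oplus P$ as $kG$-modules with $P$ projective. *)

(* Defs.v *)
(* Finite-dimensional Hopf algebras are encoded in coordinates
   (structure constants w.r.t. a basis e_0,...,e_(d-1) of kG = k^d). *)
From HB Require Import structures.
From mathcomp Require Import all_boot all_order all_algebra all_field.
Set Implicit Arguments. Unset Strict Implicit. Unset Printing Implicit Defensive.
Import GRing.Theory.
Local Open Scope ring_scope.

Section Hopf.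
Variables (k : fieldType) (d : nat).

(* Structure constants of a finite-dimensional (Hopf) algebra A = k^d.
   Elements of A are row vectors 'rV[k]_d; e_i = delta_mx 0 i.
   - hmul i j  = e_i * e_j
   - hunit     = 1_A
   - hcomul i  = Delta(e_i), an element of A (x) A = 'M_d, where the
                 (j,l) entry is the coefficient of e_j (x) e_l
   - hcounit i = epsilon(e_i)
   - hanti i   = S(e_i) *)
Record hopf_data := HopfData {
  hmul : 'I_d -> 'I_d -> 'rV[k]_d;
  hunit : 'rV[k]_d;
  hcomul : 'I_d -> 'M[k]_d;
  hcounit : 'I_d -> k;
  hanti : 'I_d -> 'rV[k]_d }.

Variable H : hopf_data.

Definition basis_el (i : 'I_d) : 'rV[k]_d := delta_mx 0 i.

Definition mulH (x y : 'rV[k]_d) : 'rV[k]_d :=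
  \sum_i \sum_j (x 0 i * y 0 j) *: hmul H i j.

Definition comulH (x : 'rV[k]_d) : 'M[k]_d := \sum_i x 0 i *: hcomul H i.

Definition counitH (x : 'rV[k]_d) : k := \sum_i x 0 i * hcounit H i.

Definition antiH (x : 'rV[k]_d) : 'rV[k]_d := \sum_i x 0 i *: hanti H i.

Definition tens (u v : 'rV[k]_d) : 'M[k]_d := u^T *m v.

Definition mulHH (X Y : 'M[k]_d) : 'M[k]_d :=
  \sum_a \sum_b \sum_c \sum_e
     (X a b * Y c e) *: tens (hmul H a c) (hmul H b e).

Definition is_unit_alg (x : 'rV[k]_d) : Prop :=
  exists y, mulH x y = hunit H /\ mulH y x = hunit H.

Definition is_cocomm_hopf : Prop :=
      (forall x y z, mulH (mulH x y) z = mulH x (mulH y z)) /\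
      (forall x, mulH (hunit H) x = x /\ mulH x (hunit H) = x) /\
      (forall i a b c, \sum_j hcomul H i j c * hcomul H j a b
                       = \sum_l hcomul H i a l * hcomul H l b c) /\
      (forall i l, \sum_j hcounit H j * hcomul H i j l = (i == l)%:R
                /\ \sum_j hcomul H i l j * hcounit H j = (i == l)%:R) /\
      (forall x y, comulH (mulH x y) = mulHH (comulH x) (comulH y)
                /\ counitH (mulH x y) = counitH x * counitH y) /\
      (comulH (hunit H) = tens (hunit H) (hunit H) /\ counitH (hunit H) = 1) /\
      (forall i, \sum_j \sum_l hcomul H i j l *: mulH (hanti H j) (basis_el l)
                   = hcounit H i *: hunit H
              /\ \sum_j \sum_l hcomul H i j l *: mulH (basis_el j) (hanti H l)
                   = hcounit H i *: hunit H) /\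
      (forall i, (hcomul H i)^T = hcomul H i).

(* Left ideals, represented as row spaces of matrices (mxalgebra). *)
Definition left_ideal (L : 'M[k]_d) : Prop :=
  forall a x : 'rV[k]_d, (x <= L)%MS -> (mulH a x <= L)%MS.

Definition maximal_left_ideal (L : 'M[k]_d) : Prop :=
  [/\ left_ideal L, ~~ (hunit H <= L)%MS &
      forall L' : 'M[k]_d, left_ideal L' -> ~~ (hunit H <= L')%MS ->
        (L <= L')%MS -> (L' == L)%MS].

Definition local_alg : Prop :=
  (exists L, maximal_left_ideal L) /\
  forall L1 L2, maximal_left_ideal L1 -> maximal_left_ideal L2 -> (L1 == L2)%MS.

(* A finite-dimensional module: k^hdim (column vectors), e_i acting by hact i *)
Record hmod := HMod { hdim : nat; hact : 'I_d -> 'M[k]_hdim }.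

Definition rho (M : hmod) (x : 'rV[k]_d) : 'M[k]_(hdim M) :=
  \sum_i x 0 i *: hact M i.

Definition is_module (M : hmod) : Prop :=
  rho M (hunit H) = 1%:M /\
  forall x y, rho M (mulH x y) = rho M x *m rho M y.

Definition mod_iso (M N : hmod) : Prop :=
  exists (T : 'M[k]_(hdim N, hdim M)) (U : 'M[k]_(hdim M, hdim N)),
    [/\ T *m U = 1%:M, U *m T = 1%:M &
        forall i, T *m hact M i = hact N i *m T].

Definition kron m1 n1 m2 n2 (A : 'M[k]_(m1, n1)) (B : 'M[k]_(m2, n2))
  : 'M[k]_(m1 * m2, n1 * n2) :=
  \matrix_(r, s) \sum_(a : 'I_m1) \sum_(b : 'I_m2) \sum_(c : 'I_n1) \sum_(e : 'I_n2)
     (if (mxvec_index a b == r) && (mxvec_index c e == s)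
      then A a c * B b e else 0).

Definition tensor_mod (M N : hmod) : hmod :=
  @HMod (hdim M * hdim N)
    (fun i => \sum_j \sum_l hcomul H i j l *: kron (hact M j) (hact N l)).

Definition dual_mod (M : hmod) : hmod :=
  @HMod (hdim M) (fun i => (rho M (hanti H i))^T).

Definition triv_mod : hmod := @HMod 1 (fun i => (hcounit H i)%:M).

Definition dsum_mod (M N : hmod) : hmod :=
  @HMod (hdim M + hdim N) (fun i => block_mx (hact M i) 0 0 (hact N i)).

Definition zero_mod : hmod := @HMod 0 (fun _ => 0).

Definition reg_mod : hmod :=
  @HMod d (fun i => \matrix_(r, l) hmul H i l 0 r).

Fixpoint free_mod (m : nat) : hmod :=
  if m is m'.+1 then dsum_mod reg_mod (free_mod m') else zero_mod.

Definition projective_mod (P : hmod) : Prop :=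
  is_module P /\
  exists (Q : hmod) (m : nat), is_module Q /\ mod_iso (dsum_mod P Q) (free_mod m).

Definition endotrivial (M : hmod) : Prop :=
  is_module M /\
  exists P : hmod, projective_mod P /\
    mod_iso (tensor_mod (dual_mod M) M) (dsum_mod triv_mod P).

End Hopf.

(* Main.v *)
(* Let s span the integrals of A = kG, i.e. the socle of the local Frobenius algebra A
   (d = dim A). For every module X, splitting off the submodules A x with s x <> 0 shows
   that X = A^r (+) X' with r the rank of s on X and s X' = 0. Let M be endotrivial of
   dimension n, so that n^2 = m d + 1 and s has rank at least m on M^* (x) M.
   If L is a module of dimension n such that s has rank at least m on M^* (x) L, then
   M^* (x) L = A^m (+) k; tensoring with M and using that A (x) N is free for all N gives
   A^t (+) L = A^t (+) M, whence L = M by cancellation. So the isomorphism class of M is cut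
   out by the non-vanishing of m x m minors, which are polynomials of degree m in the matrix
   entries of L; these span a finite-dimensional space, hence finitely many classes suffice. *)
Require Import Defs.
From HB Require Import structures.
From mathcomp Require Import all_boot all_order all_algebra all_field.
From mathcomp Require Import perm.
From Stdlib Require Import Classical.
Import GRing.Theory.
Local Open Scope ring_scope.
Set Implicit Arguments. Unset Strict Implicit. Unset Printing Implicit Defensive.

(** The Frobenius property is derived from the Hopf axioms: the integrals tensored with A^* embed
    into A, so they span at most a line, and a functional equal to 1 on s then gives a nondegenerate
    form. After m copies of A are split off M^* (x) L, the dimension leaves a one-dimensional
    module, and a local A has no such module but k. The obstacle in the final step is that the
    relevant minor depends on M, so infinitely many minors are in play. They are all functionals on
    one space with a basis of N monomials, N depending only on n and d. The minor of M does not
    vanish at M; if all minors chosen so far vanish there, it lies outside their span, which can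
    happen at most N times. *)

(** * Linear maps on [k^d] and their expansion on the basis *)

Section LinearMaps.
Variables (k : fieldType) (d : nat).
Local Notation A := 'rV[k]_d.
Local Notation e := (@basis_el k d).

Definition lin (V : lmodType k) (F : A -> V) : Prop :=
  forall c u v, F (c *: u + v) = c *: F u + F v.

Lemma lin0 (V : lmodType k) (F : A -> V) : lin F -> F 0 = 0.
Proof. by move=> lF; have := lF (-1) 0 0; rewrite scaler0 add0r scaleN1r addNr. Qed.

Lemma linD (V : lmodType k) (F : A -> V) u v : lin F -> F (u + v) = F u + F v.
Proof. by move=> lF; have := lF 1 u v; rewrite !scale1r. Qed.

Lemma linZ (V : lmodType k) (F : A -> V) c u : lin F -> F (c *: u) = c *: F u.
Proof. by move=> lF; have := lF c u 0; rewrite (lin0 lF) !addr0. Qed.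

Lemma lin_sum (V : lmodType k) (F : A -> V) (I : Type) (r : seq I) (P : pred I) (G : I -> A) :
  lin F -> F (\sum_(i <- r | P i) G i) = \sum_(i <- r | P i) F (G i).
Proof.
move=> lF; elim/big_rec2: _ => [|i x y _ <-]; first exact: lin0.
exact: linD.
Qed.

Lemma lin_expand (V : lmodType k) (F : A -> V) x : lin F -> F x = \sum_i x 0 i *: F (e i).
Proof.
move=> lF; rewrite {1}(row_sum_delta x) lin_sum //.
by apply: eq_bigr => i _; rewrite linZ.
Qed.

Lemma lin_basis_sum (V : lmodType k) (h : 'I_d -> V) : lin (fun x => \sum_i x 0 i *: h i).
Proof.
move=> c u v; rewrite scaler_sumr -big_split; apply: eq_bigr => i _ /=.
by rewrite !mxE scalerDl scalerA.
Qed.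

Lemma basis_sum (V : lmodType k) (h : 'I_d -> V) j : \sum_i e j 0 i *: h i = h j.
Proof.
rewrite (bigD1 j) //= mxE !eqxx scale1r big1 ?addr0 // => i /negPf ij.
by rewrite mxE eqxx ij scale0r.
Qed.

Lemma lin_mulmxl m (B : 'M[k]_(d, m)) : lin (fun x => x *m B).
Proof. by move=> c u v; rewrite mulmxDl scalemxAl. Qed.

Lemma lin_scale (V : lmodType k) (F : A -> V) a : lin F -> lin (fun x => a *: F x).
Proof. by move=> lF c u v; rewrite lF scalerDr !scalerA mulrC. Qed.

Lemma lin_scalel (V : lmodType k) (c : A -> k) (v : V) :
  lin (c : A -> k^o) -> lin (fun x => c x *: v).
Proof. by move=> lF a u w; rewrite lF scalerDl scalerA. Qed.

Lemma lin_sumF (V : lmodType k) (I : finType) (F : I -> A -> V) :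
  (forall i, lin (F i)) -> lin (fun x => \sum_i F i x).
Proof.
move=> lF c u v; rewrite scaler_sumr -big_split; apply: eq_bigr => i _ /=; exact: lF.
Qed.

End LinearMaps.

(** * Sweedler sums: bilinear expressions in the comultiplication *)

Section SweedlerSum.
Variables (k : fieldType) (d : nat) (H : hopf_data k d).
Local Notation A := 'rV[k]_d.
Local Notation e := (@basis_el k d).
Local Notation S := (antiH H).
Local Notation eps := (counitH H).
Local Notation "x ** y" := (mulH H x y) (at level 40, left associativity).

Lemma lin_mull y : lin (fun x => x ** y).
Proof.
rewrite /mulH => c u v; rewrite scaler_sumr -big_split; apply: eq_bigr => i _ /=.
rewrite scaler_sumr -big_split; apply: eq_bigr => j _ /=.
by rewrite !mxE mulrDl scalerDl -!mulrA scalerA.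
Qed.

Lemma lin_mulr y : lin (fun x => y ** x).
Proof.
rewrite /mulH => c u v; rewrite scaler_sumr -big_split; apply: eq_bigr => i _ /=.
rewrite scaler_sumr -big_split; apply: eq_bigr => j _ /=.
by rewrite !mxE mulrDr scalerDl scalerA; congr (_ *: _ + _); rewrite mulrCA.
Qed.

Lemma lin_anti : lin S. Proof. exact: lin_basis_sum. Qed.
Lemma lin_eps : lin (eps : A -> k^o). Proof. exact: lin_basis_sum. Qed.
Lemma lin_comul : lin (comulH H). Proof. exact: lin_basis_sum. Qed.
Lemma lin_rho M : lin (@rho k d M). Proof. exact: lin_basis_sum. Qed.

Lemma anti_basis i : S (e i) = hanti H i. Proof. exact: basis_sum. Qed.
Lemma eps_basis i : eps (e i) = hcounit H i. Proof. exact: (@basis_sum k d k^o). Qed.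
Lemma comul_basis i : comulH H (e i) = hcomul H i. Proof. exact: basis_sum. Qed.
Lemma rho_basis M i : @rho k d M (e i) = hact M i. Proof. exact: basis_sum. Qed.

Lemma lin_compA (V : lmodType k) (F : A -> A) (G : A -> V) :
  lin F -> lin G -> lin (fun x => G (F x)).
Proof. by move=> lF lG c u v; rewrite lF lG. Qed.

(* Sweedler notation: [sweedler x F] is the sum of the F x_(1) x_(2). *)
Definition sweedler (V : lmodType k) (x : A) (F : A -> A -> V) : V :=
  \sum_j \sum_l comulH H x j l *: F (e j) (e l).
Local Notation sw := sweedler.

Lemma eq_sw (V : lmodType k) x (F G : A -> A -> V) :
  (forall a b, F a b = G a b) -> sw x F = sw x G.
Proof. by move=> FG; apply: eq_bigr => j _; apply: eq_bigr => l _; rewrite FG. Qed.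

Lemma lin_sw (V : lmodType k) (F : A -> A -> V) : lin (fun x => sw x F).
Proof.
move=> c u v; rewrite /sweedler scaler_sumr -big_split; apply: eq_bigr => i _ /=.
rewrite scaler_sumr -big_split; apply: eq_bigr => j _ /=.
by rewrite lin_comul !mxE scalerDl scalerA.
Qed.

Lemma lin_swF n (V : lmodType k) t (F : 'rV[k]_n -> A -> A -> V) :
  (forall a b, lin (fun x => F x a b)) -> lin (fun x => sw t (F x)).
Proof.
move=> lF; rewrite /sweedler; apply: lin_sumF => i; apply: lin_sumF => j.
exact: lin_scale.
Qed.

Lemma sw_lin (V : lmodType k) x (F : A -> A -> A) (G : A -> V) :
  lin G -> G (sw x F) = sw x (fun a b => G (F a b)).
Proof.
move=> lG; rewrite /sweedler lin_sum //; apply: eq_bigr => i _; rewrite lin_sum //.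
by apply: eq_bigr => j _; rewrite linZ.
Qed.

Lemma sw_scale (V : lmodType k) x (F : A -> A -> V) c : 
  sw x (fun a b => c *: F a b) = c *: sw x F.
Proof.
rewrite /sweedler scaler_sumr; apply: eq_bigr => i _; rewrite scaler_sumr.
by apply: eq_bigr => j _; rewrite !scalerA mulrC.
Qed.

Lemma sw_exchange (V : lmodType k) x y (F : A -> A -> A -> A -> V) :
  sw x (fun a b => sw y (fun c e => F a b c e)) =
  sw y (fun c e => sw x (fun a b => F a b c e)).
Proof.
rewrite /sweedler.
transitivity (\sum_i \sum_j \sum_i0 \sum_j0
  (comulH H x i j * comulH H y i0 j0) *: F (e i) (e j) (e i0) (e j0)).
  apply: eq_bigr => i _; apply: eq_bigr => j _; rewrite scaler_sumr.
  by apply: eq_bigr => i0 _; rewrite scaler_sumr; apply: eq_bigr => j0 _; rewrite scalerA.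
rewrite pair_big /=; under eq_bigr do rewrite pair_big /=.
rewrite exchange_big /= [RHS]pair_big /=; apply: eq_bigr => -[i0 j0] _ /=.
rewrite scaler_sumr [RHS](eq_bigr (fun i => \sum_j (comulH H x i j * comulH H y i0 j0) *: F (e i) (e j) (e i0) (e j0))); last first.
  by move=> i _; rewrite scaler_sumr; apply: eq_bigr => j _; rewrite scalerA mulrC.
by rewrite pair_big.
Qed.

End SweedlerSum.

(** * The Hopf axioms as identities between Sweedler sums *)

Section Sweedler.
Variables (k : fieldType) (d : nat) (H : hopf_data k d).
Hypothesis hH : is_cocomm_hopf H.
Local Notation A := 'rV[k]_d.
Local Notation e := (@basis_el k d).
Local Notation S := (antiH H).
Local Notation eps := (counitH H).
Local Notation sw := (sweedler H).
Local Notation "1H" := (hunit H).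
Local Notation "x ** y" := (mulH H x y) (at level 40, left associativity).

Lemma mulHA x y z : x ** y ** z = x ** (y ** z). Proof. by case: hH. Qed.
Lemma mul1H x : 1H ** x = x. Proof. by case: hH => _ [/(_ x) []]. Qed.
Lemma mulH1 x : x ** 1H = x. Proof. by case: hH => _ [/(_ x) []]. Qed.
Lemma epsM x y : eps (x ** y) = eps x * eps y.
Proof. by case: hH => _ [_ [_ [_ [/(_ x y) []]]]]. Qed.
Lemma eps1 : eps 1H = 1.
Proof. by case: hH => _ [_ [_ [_ [_ [[]]]]]]. Qed.
Lemma hcomulC i j l : hcomul H i j l = hcomul H i l j.
Proof.
by case: hH => _ [_ [_ [_ [_ [_ [_ /(_ i)/matrixP/(_ l j)]]]]]]; rewrite mxE.
Qed.
Lemma hcomulA i a b c : \sum_j hcomul H i j c * hcomul H j a b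
                       = \sum_l hcomul H i a l * hcomul H l b c.
Proof. by case: hH => _ [_ [-> ]]. Qed.
Lemma hcounitl i l : \sum_j hcounit H j * hcomul H i j l = (i == l)%:R.
Proof. by case: hH => _ [_ [_ [/(_ i l) []]]]. Qed.

Lemma sw_basis (V : lmodType k) i (F : A -> A -> V) :
  sw (e i) F = \sum_j \sum_l hcomul H i j l *: F (e j) (e l).
Proof. by rewrite /sweedler comul_basis. Qed.

Lemma swC (V : lmodType k) x (F : A -> A -> V) : sw x F = sw x (fun a b => F b a).
Proof.
rewrite (lin_expand x (lin_sw _ F)) (lin_expand x (lin_sw _ (fun a b => F b a))).
apply: eq_bigr => i _; rewrite !sw_basis exchange_big /=; congr (_ *: _).
by apply: eq_bigr => j _; apply: eq_bigr => l _; rewrite hcomulC.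
Qed.

(** Both bracketings are reduced to the coefficient of [G (e a) (e b) (e c)], where coassociativity
    is an identity of structure constants. *)
Lemma swA (V : lmodType k) x (G : A -> A -> A -> V) :
  sw x (fun a b => sw a (fun c f => G c f b)) = sw x (fun a b => sw b (fun c f => G a c f)).
Proof.
rewrite (lin_expand x (lin_sw _ _)) [RHS](lin_expand x (lin_sw _ _)).
apply: eq_bigr => i _; congr (_ *: _); rewrite !sw_basis.
transitivity (\sum_a \sum_b \sum_c (\sum_j hcomul H i j c * hcomul H j a b) *: G (e a) (e b) (e c)).
  rewrite exchange_big /=.
  transitivity (\sum_c \sum_a \sum_b (\sum_j hcomul H i j c * hcomul H j a b) *: G (e a) (e b) (e c)).
    apply: eq_bigr => c _.
    under eq_bigr do rewrite sw_basis scaler_sumr.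
    rewrite exchange_big /=; apply: eq_bigr => a _.
    under eq_bigr do rewrite scaler_sumr.
    rewrite exchange_big /=; apply: eq_bigr => b _.
    by rewrite scaler_suml; apply: eq_bigr => j _; rewrite scalerA.
  by rewrite exchange_big; apply: eq_bigr => a _; rewrite exchange_big.
apply: eq_bigr => a _.
transitivity (\sum_b \sum_c \sum_l (hcomul H i a l * hcomul H l b c) *: G (e a) (e b) (e c)).
  by apply: eq_bigr => b _; apply: eq_bigr => c _; rewrite hcomulA scaler_suml.
under eq_bigr do rewrite exchange_big.
rewrite exchange_big; apply: eq_bigr => l _; rewrite sw_basis scaler_sumr; apply: eq_bigr => b _.
by rewrite scaler_sumr; apply: eq_bigr => c _; rewrite scalerA.
Qed.

Lemma sw_epsl (V : lmodType k) x (F : A -> V) :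
  lin F -> sw x (fun a b => eps a *: F b) = F x.
Proof.
move=> lF; rewrite (lin_expand x (lin_sw _ _)) (lin_expand x lF).
apply: eq_bigr => i _; congr (_ *: _); rewrite sw_basis exchange_big /=.
rewrite (bigD1 i) //= [X in _ + X]big1 => [|l /negPf li];
  under eq_bigr do rewrite eps_basis scalerA mulrC; rewrite -scaler_suml hcounitl.
  by rewrite eqxx scale1r addr0.
by rewrite eq_sym li scale0r.
Qed.

Lemma sw_epsr (V : lmodType k) x (F : A -> V) :
  lin F -> sw x (fun a b => eps b *: F a) = F x.
Proof. by move=> lF; rewrite swC sw_epsl. Qed.

Lemma sw_antil x : sw x (fun a b => S a ** b) = eps x *: 1H.
Proof.
rewrite (lin_expand x (lin_sw _ _)) [eps x](lin_expand x (lin_eps H)) scaler_suml.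
apply: eq_bigr => i _; rewrite sw_basis -[RHS]scalerA; congr (_ *: _); rewrite eps_basis.
case: hH => _ [_ [_ [_ [_ [_ [/(_ i) [<- _] _]]]]]].
by apply: eq_bigr => j _; apply: eq_bigr => l _; rewrite anti_basis.
Qed.

Lemma sw_antir x : sw x (fun a b => a ** S b) = eps x *: 1H.
Proof.
rewrite (lin_expand x (lin_sw _ _)) [eps x](lin_expand x (lin_eps H)) scaler_suml.
apply: eq_bigr => i _; rewrite sw_basis -[RHS]scalerA; congr (_ *: _); rewrite eps_basis.
case: hH => _ [_ [_ [_ [_ [_ [/(_ i) [_ <-] _]]]]]].
by apply: eq_bigr => j _; apply: eq_bigr => l _; rewrite anti_basis.
Qed.

Definition bilin (V : lmodType k) (F : A -> A -> V) : Prop :=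
  (forall b, lin (F^~ b)) /\ (forall a, lin (F a)).

Lemma sum_tens (V : lmodType k) (u v : A) (F : A -> A -> V) : bilin F ->
  \sum_j \sum_l tens u v j l *: F (e j) (e l) = F u v.
Proof.
move=> [lF1 lF2]; rewrite (lin_expand u (lF1 v)); apply: eq_bigr => j _.
rewrite (lin_expand v (lF2 _)) scaler_sumr; apply: eq_bigr => l _.
by rewrite scalerA /tens mxE big_ord1 mxE.
Qed.

Lemma sw1 (V : lmodType k) (F : A -> A -> V) : bilin F -> sw 1H F = F 1H 1H.
Proof.
move=> bF; rewrite /sweedler; case: hH => _ [_ [_ [_ [_ [[-> _] _]]]]]; exact: sum_tens.
Qed.

Lemma mulH_basis i j : e i ** e j = hmul H i j.
Proof.
rewrite /mulH (bigD1 i) //= [X in _ + X]big1 => [|a /negPf ai].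
  rewrite (bigD1 j) //= big1 => [|b /negPf bj]; rewrite !mxE ?eqxx ?bj ?mulr0 ?scale0r //.
  by rewrite mulr1 scale1r !addr0.
by rewrite big1 // => b _; rewrite mxE eqxx ai mul0r scale0r.
Qed.

Lemma swM (V : lmodType k) x y (F : A -> A -> V) : bilin F ->
  sw (x ** y) F = sw x (fun a b => sw y (fun c f => F (a ** c) (b ** f))).
Proof.
move=> bF; rewrite /sweedler; case: hH => _ [_ [_ [_ [/(_ x y) [-> _] _]]]].
(* [G] is the linear extension of [F] to A (x) A; [mulHH] is a combination of pure tensors, on which
   [G] returns [F]. *)
pose G (X : 'M[k]_d) := \sum_j \sum_l X j l *: F (e j) (e l).
have lG : forall c u v, G (c *: u + v) = c *: G u + G v.
  move=> c u v; rewrite /G scaler_sumr -big_split; apply: eq_bigr => i _ /=.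
  rewrite scaler_sumr -big_split; apply: eq_bigr => j _ /=.
  by rewrite !mxE scalerDl scalerA.
have G0 : G 0 = 0.
  by rewrite /G big1 // => i _; rewrite big1 // => j _; rewrite mxE scale0r.
have Gs (I : finType) (h : I -> 'M[k]_d) : G (\sum_i h i) = \sum_i G (h i).
  elim/big_rec2: _ => // i u v _ <-; by have := lG 1 (h i) v; rewrite !scale1r.
have GZ c u : G (c *: u) = c *: G u by have := lG c u 0; rewrite G0 !addr0.
rewrite -/(G _) /mulHH Gs; apply: eq_bigr => a _; rewrite Gs; apply: eq_bigr => b _.
rewrite Gs scaler_sumr; apply: eq_bigr => c _; rewrite Gs scaler_sumr; apply: eq_bigr => f _.
by rewrite GZ scalerA /G sum_tens // !mulH_basis.
Qed.

End Sweedler.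

(** * Units and left ideals of a local Hopf algebra; existence of integrals *)

Section LocalAlgebra.
Variables (k : fieldType) (d : nat) (H : hopf_data k d).
Hypothesis hH : is_cocomm_hopf H.
Local Notation A := 'rV[k]_d.
Local Notation e := (@basis_el k d).
Local Notation eps := (counitH H).
Local Notation "1H" := (hunit H).
Local Notation "x ** y" := (mulH H x y) (at level 40, left associativity).

Definition linmx n (F : A -> 'rV[k]_n) : 'M[k]_(d, n) := \matrix_i F (e i).

Lemma mul_linmx n (F : A -> 'rV[k]_n) x : lin F -> x *m linmx F = F x.
Proof.
move=> lF; rewrite mulmx_sum_row (lin_expand x lF).
by apply: eq_bigr => i _; rewrite rowK.
Qed.

Lemma mulDH x y z : (x + y) ** z = x ** z + y ** z.
Proof. exact: linD (lin_mull H z). Qed.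
Lemma mulHD x y z : z ** (x + y) = z ** x + z ** y.
Proof. exact: linD (lin_mulr H z). Qed.
Lemma mulZH c x y : (c *: x) ** y = c *: (x ** y).
Proof. exact: linZ (lin_mull H y). Qed.
Lemma mulHZ c x y : y ** (c *: x) = c *: (y ** x).
Proof. exact: linZ (lin_mulr H y). Qed.
Lemma mulNH x y : (- x) ** y = - (x ** y).
Proof. by rewrite -scaleN1r mulZH scaleN1r. Qed.
Lemma mulHN x y : y ** (- x) = - (y ** x).
Proof. by rewrite -scaleN1r mulHZ scaleN1r. Qed.
Lemma mul0H x : 0 ** x = 0. Proof. exact: lin0 (lin_mull H x). Qed.
Lemma mulH0 x : x ** 0 = 0. Proof. exact: lin0 (lin_mulr H x). Qed.
Lemma epsD x y : eps (x + y) = eps x + eps y.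
Proof. exact: linD (lin_eps H). Qed.
Lemma epsZ c x : eps (c *: x) = c * eps x.
Proof. exact: linZ (lin_eps H). Qed.
Lemma epsB x y : eps (x - y) = eps x - eps y.
Proof. by rewrite epsD -scaleN1r epsZ mulN1r. Qed.

Lemma hunit_neq0 : 1H != 0.
Proof.
apply/eqP => h0; have := eps1 hH; rewrite h0 (lin0 (lin_eps H)) => /esym/eqP.
by rewrite oner_eq0.
Qed.

Definition epscol : 'cV[k]_d := \col_i hcounit H i.

Lemma mul_epscol x : x *m epscol = (eps x)%:M.
Proof.
apply/matrixP => i j; rewrite !ord1 !mxE eqxx mulr1n /counitH.
by apply: eq_bigr => a _; rewrite mxE.
Qed.

Definition aug_ideal : 'M[k]_d := kermx epscol.

Lemma aug_idealP x : (x <= aug_ideal)%MS = (eps x == 0).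
Proof.
rewrite sub_kermx mul_epscol; apply/eqP/eqP => [/matrixP/(_ 0 0)|->].
  by rewrite !mxE.
by rewrite raddf0.
Qed.

Lemma left_ideal_aug : left_ideal H aug_ideal.
Proof. by move=> a x; rewrite !aug_idealP (epsM hH) => /eqP->; rewrite mulr0. Qed.

Lemma proper_left_ideal_rank L : left_ideal H L -> ~~ (1H <= L)%MS -> (\rank L < d)%N.
Proof.
move=> _; apply: contraNT; rewrite -leqNgt => rL; apply: submx_full.
by rewrite /row_full eqn_leq rank_leq_col.
Qed.

(** The kernel of a single functional has rank at least [d.-1], while a proper left ideal has rank
    below [d]. *)
Lemma maximal_aug : maximal_left_ideal H aug_ideal.
Proof.
split; [exact: left_ideal_aug| by rewrite aug_idealP (eps1 hH) oner_eq0 |].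
move=> L' lL' nL' sL; rewrite andbC sL /=.
have rL := proper_left_ideal_rank lL' nL'.
have rA : (d.-1 <= \rank aug_ideal)%N.
  by rewrite mxrank_ker -subn1 leq_sub2l // rank_leq_col.
rewrite -(geq_leqif (mxrank_leqif_sup sL)).
by apply: leq_trans rA; rewrite -ltnS; apply: leq_trans rL _; case: (d).
Qed.

Hypothesis hloc : local_alg H.

(** Induction on the codimension: a proper left ideal either is maximal, hence the augmentation
    ideal by locality, or lies strictly inside a larger proper one. *)
Lemma left_ideal_sub_aug L : left_ideal H L -> ~~ (1H <= L)%MS -> (L <= aug_ideal)%MS.
Proof.
move: {2}(d - \rank L)%N (leqnn (d - \rank L)%N) => m; elim: m L => [|m IH] L hm lL nL.
  by have := proper_left_ideal_rank lL nL; rewrite -subn_gt0 lt0n -leqn0 hm.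
have [mL|nmL] := classic (maximal_left_ideal H L).
  by have /andP[] := hloc.2 _ _ mL maximal_aug.
have [L' [lL' nL' sL neL]] : exists L', [/\ left_ideal H L', ~~ (1H <= L')%MS,
    (L <= L')%MS & ~~ (L' <= L)%MS].
  apply: NNPP => hn; apply: nmL; split=> // L' lL' nL' sL.
  rewrite andbC sL /=; have [//|neL] := boolP (L' <= L)%MS.
  by case: hn; exists L'.
apply: (submx_trans sL); apply: IH => //.
have r1 : (\rank L < \rank L')%N by rewrite (ltn_leqif (mxrank_leqif_sup sL)).
have r2 := proper_left_ideal_rank lL' nL'.
rewrite -ltnS; apply: leq_trans hm; apply: ltn_sub2l => //; exact: leq_trans r1 (ltnW r2).
Qed.

Lemma left_ideal_linmx (F : A -> A) : lin F ->
  (forall a y, exists z, a ** F y = F z) -> left_ideal H (linmx F).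
Proof.
move=> lF hF a x /submxP[D ->]; rewrite mul_linmx //; have [z ->] := hF a D.
by rewrite -(mul_linmx z lF) submxMl.
Qed.

(** [A u] is a left ideal containing [u], so it is not inside the augmentation ideal and must
    contain 1. *)
Lemma eps_neq0_linv u : eps u != 0 -> exists v, v ** u = 1H.
Proof.
move=> eu; pose J := linmx (fun x => x ** u).
have lF := lin_mull H u.
have lJ : left_ideal H J.
  by apply: left_ideal_linmx => // a y; exists (a ** y); rewrite (mulHA hH).
have [/submxP[D hD]|n1] := boolP (1H <= J)%MS.
  by exists D; rewrite hD mul_linmx.
have := left_ideal_sub_aug lJ n1 => sJ.
have : (u <= aug_ideal)%MS.
  by apply: submx_trans sJ; rewrite -[u in (u <= _)%MS](mul1H hH) -(mul_linmx 1H lF) submxMl.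
by rewrite aug_idealP (negPf eu).
Qed.

(** The left inverse [v] has nonzero counit as well, so it has a left inverse [w], and
    [w = w v u = u]. *)
Lemma eps_neq0_unit u : eps u != 0 -> exists v, v ** u = 1H /\ u ** v = 1H.
Proof.
move=> eu; have [v hv] := eps_neq0_linv eu; exists v; split=> //.
have : eps v != 0.
  have := oner_neq0 k; rewrite -(eps1 hH) -hv (epsM hH); apply: contraNneq => ->.
  by rewrite mul0r.
by case/eps_neq0_linv=> w hw; rewrite -[u](mul1H hH) -{1}hw (mulHA hH w) hv (mulH1 hH).
Qed.

(** Left integrals in the Hopf sense; for local A they form the socle, the trivial module being the
    only simple one. *)
Definition integral x := forall a, a ** x = eps a *: x.

(* Nakayama: if I x contains x for the augmentation ideal I, then x = i x with 1 - i a unit. *)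
Lemma left_ideal_integral L : left_ideal H L -> L != 0 ->
  exists x, [/\ (x <= L)%MS, x != 0 & integral x].
Proof.
move: {2}(\rank L) (leqnn (\rank L)) => m; elim: m L => [|m IH] L hm lL nL.
  by move: hm; rewrite leqn0 mxrank_eq0 (negPf nL).
have [x xL x0] : exists2 x : A, (x <= L)%MS & x != 0.
  have /rowV0Pn[x xL x0] := nL; by exists x.
(* [y - eps y *: 1H] projects [y] to the augmentation ideal I, so the image of [F] is [I x]; it is
   zero exactly when [x] is an integral. *)
pose F y := (y - eps y *: 1H) ** x.
have lF : lin F.
  move=> c u v; rewrite /F epsD epsZ mulDH mulNH mulZH !mulDH !mulNH !mulZH !(mul1H hH).
  by rewrite scalerBr scalerDl !scalerA opprD addrACA.
have augF z : eps z = 0 -> F z = z ** x by rewrite /F => ->; rewrite scale0r subr0.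
have epsF y : eps (y - eps y *: 1H) = 0 by rewrite epsB epsZ (eps1 hH) mulr1 subrr.
have lJ : left_ideal H (linmx F).
  apply: left_ideal_linmx => // a y; exists (a ** (y - eps y *: 1H)).
  by rewrite [RHS]augF ?(epsM hH) ?epsF ?mulr0 // /F -(mulHA hH).
have sJ : (linmx F <= L)%MS.
  by apply/row_subP => i; rewrite rowK; exact: lL.
have [J0|Jn0] := eqVneq (linmx F) 0.
  exists x; split=> // a; have := mul_linmx a lF; rewrite J0 mulmx0 /F.
  by rewrite mulDH mulNH mulZH (mul1H hH) => /esym/eqP; rewrite subr_eq0 => /eqP.
have [hr|hr] := ltnP (\rank (linmx F)) (\rank L).
  have [|z [zJ z0 iz]] := IH _ _ lJ Jn0; first by rewrite -ltnS; apply: leq_trans hm.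
  by exists z; split=> //; apply: submx_trans sJ.
have /submxP[y hy] : (x <= linmx F)%MS.
  by apply: submx_trans xL _; rewrite -(geq_leqif (mxrank_leqif_sup sJ)).
rewrite mul_linmx // /F in hy.
have [|v [hv _]] := @eps_neq0_unit (1H - (y - eps y *: 1H)).
  by rewrite epsB epsF subr0 (eps1 hH) oner_eq0.
case/eqP: x0; rewrite -[x](mul1H hH) -hv (mulHA hH) mulDH mulNH (mul1H hH) -hy.
by rewrite subrr mulH0.
Qed.

End LocalAlgebra.

(** * The antipode, and a bound on the space of integrals *)

Section Integrals.
Variables (k : fieldType) (d : nat) (H : hopf_data k d).
Hypothesis hH : is_cocomm_hopf H.
Local Notation A := 'rV[k]_d.
Local Notation e := (@basis_el k d).
Local Notation S := (antiH H).
Local Notation eps := (counitH H).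
Local Notation "1H" := (hunit H).
Local Notation "x ** y" := (mulH H x y) (at level 40, left associativity).
Local Notation sw := (sweedler H).

Lemma anti1 : S 1H = 1H.
Proof.
have := sw_antil hH 1H; rewrite (sw1 hH) ?(eps1 hH) ?scale1r ?(mulH1 hH) //.
split=> a; [exact: lin_compA (lin_anti H) (lin_mull H a) | exact: lin_mulr].
Qed.

(* Both sides are convolution inverses of the multiplication map. *)
Lemma antiM x y : S (x ** y) = S y ** S x.
Proof.
have bF z : bilin (fun u v => z ** (u ** S v)).
  split=> a; first exact: lin_compA (lin_mull H _) (lin_mulr H z).
  exact: lin_compA (lin_anti H) (lin_compA (lin_mulr H a) (lin_mulr H z)).
have right_inv b f z : sw b (fun b1 b2 => sw f (fun f1 f2 => z ** ((b1 ** f1) ** S (b2 ** f2))))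
    = eps b *: (eps f *: z).
  rewrite -(swM hH _ _ (bF z)) -(sw_lin H _ _ (lin_mulr H z)) (sw_antir hH) mulHZ (mulH1 hH).
  by rewrite (epsM hH) scalerA.
have left_inv b f z : sw b (fun b1 b2 => sw f (fun f1 f2 => (S f1 ** S b1) ** ((b2 ** f2) ** z)))
    = eps b *: (eps f *: z).
  rewrite sw_exchange.
  transitivity (sw f (fun f1 f2 => eps b *: ((S f1 ** f2) ** z))).
    apply: eq_sw => f1 f2.
    transitivity (S f1 ** (sw b (fun b1 b2 => S b1 ** b2) ** (f2 ** z))).
      rewrite (sw_lin H _ _ (lin_mull H _)) (sw_lin H _ _ (lin_mulr H _)).
      by apply: eq_sw => b1 b2; rewrite !(mulHA hH).
    by rewrite (sw_antil hH) mulZH mulHZ (mul1H hH) (mulHA hH).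
  by rewrite sw_scale -(sw_lin H _ _ (lin_mull H z)) (sw_antil hH) mulZH (mul1H hH).
transitivity (sw x (fun a b => sw y (fun c f => eps b *: (eps f *: (S c ** S a))))).
  transitivity (sw x (fun x1 x2 => sw y (fun y1 y2 => eps x1 *: (eps y1 *: S (x2 ** y2))))).
    transitivity (sw x (fun x1 x2 => eps x1 *: S (x2 ** y))).
      by rewrite (sw_epsl hH) //; exact: lin_compA (lin_mull H y) (lin_anti H).
    apply: eq_sw => x1 x2; rewrite sw_scale (sw_epsl hH) //.
    exact: lin_compA (lin_mulr H _) (lin_anti H).
  (* Uniqueness of convolution inverses: the counits of [x1] and [y1] are expanded by [left_inv],
     the sums are re-bracketed, and [right_inv] collapses the other half. *)
  transitivity (sw x (fun x1 x2 => sw x1 (fun a b1 => sw y (fun y1 y2 => sw y1 (fun c f1 =>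
     (S c ** S a) ** ((b1 ** f1) ** S (x2 ** y2))))))).
    apply: eq_sw => x1 x2; rewrite sw_exchange; apply: eq_sw => y1 y2.
    by rewrite left_inv.
  rewrite (swA hH); apply: eq_sw => a b; rewrite sw_exchange.
  transitivity (sw y (fun y1 y2 => sw y1 (fun c f1 => sw b (fun b1 b2 =>
     (S c ** S a) ** ((b1 ** f1) ** S (b2 ** y2)))))).
    by apply: eq_sw => y1 y2; rewrite sw_exchange.
  rewrite (swA hH); apply: eq_sw => c f; rewrite sw_exchange right_inv.
  by [].
transitivity (sw x (fun a b => eps b *: (S y ** S a))).
  apply: eq_sw => a b; rewrite sw_scale (sw_epsr hH) //.
  exact: lin_compA (lin_anti H) (lin_mull H _).
by rewrite (sw_epsr hH) //; exact: lin_compA (lin_anti H) (lin_mulr H _).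
Qed.

(** The Casimir property of [t_(1) (x) S(t_(2))]. Inserting [S(a_(2)) a_(3)] for a counit of [a]
    produces [a_(1) t_(1)] and [S(a_(2) t_(2)) a_(3)]; the first two legs of [a] now multiply the
    comultiplication of [t] and are absorbed by the integral. *)
Lemma sw_integral (V : lmodType k) t a (F : A -> A -> V) : bilin F -> integral H t ->
  sw t (fun p q => F (a ** p) (S q)) = sw t (fun p q => F p (S q ** a)).
Proof.
move=> bF it.
transitivity (sw a (fun a1 a' => sw a' (fun a2 a3 => sw t (fun p q =>
    F (a1 ** p) (S (a2 ** q) ** a3))))).
  transitivity (sw a (fun a1 a' => eps a' *: sw t (fun p q => F (a1 ** p) (S q)))).
    rewrite (sw_epsr hH a (F := fun x => sw t (fun p q => F (x ** p) (S q)))) //.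
    apply: lin_swF => p q; exact: lin_compA (lin_mull H p) (bF.1 _).
  apply: eq_sw => a1 a'; rewrite sw_exchange -sw_scale; apply: eq_sw => p q.
  transitivity (F (a1 ** p) (S q ** (eps a' *: 1H))).
    by rewrite mulHZ (mulH1 hH) (linZ _ _ (bF.2 _)).
  rewrite -(sw_antil hH) (sw_lin H _ _ (lin_mulr H _)) (sw_lin H _ _ (bF.2 _)).
  by apply: eq_sw => b c; rewrite antiM (mulHA hH).
rewrite -(swA hH a (fun a1 a2 a3 => sw t (fun p q => F (a1 ** p) (S (a2 ** q) ** a3)))).
transitivity (sw a (fun b a3 => eps b *: sw t (fun p q => F p (S q ** a3)))).
  apply: eq_sw => b a3; rewrite -(swM hH b t (F := fun u v => F u (S v ** a3))).
    by rewrite it (linZ _ _ (lin_sw H _)).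
  split=> c; first exact: bF.1.
  exact: lin_compA (lin_anti H) (lin_compA (lin_mull H _) (bF.2 c)).
rewrite (sw_epsl hH a (F := fun x => sw t (fun p q => F p (S q ** x)))) //.
apply: lin_swF => p q; exact: lin_compA (lin_mulr H _) (bF.2 _).
Qed.

(** Write [phi(v) t] as the sum of [phi(S(t_(2)) t_(3) v) t_(1)], rotate the three legs by
    cocommutativity, and expand the leg next to [v] on the basis. Thus [phi(v) t] depends linearly
    on the elements [phi(S(t_(2)) w) t_(1)] with [w] in A, which is what injectivity requires
    below. *)
Lemma integral_reconstruction t (phi : A -> k) v : lin (phi : A -> k^o) ->
  phi v *: t = \sum_j sw (sw t (fun p q => phi (S q ** (e j ** v)) *: p)) (fun y p => y 0 j *: p).
Proof.
move=> lphi.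
have lco j : lin (fun y : A => (y 0 j : k^o)) by move=> c u w; rewrite !mxE.
transitivity (sw t (fun p q' => eps q' *: (phi v *: p))).
  rewrite (sw_epsr hH t (F := fun p => phi v *: p)) //.
  by move=> c u w; rewrite scalerDr !scalerA mulrC.
transitivity (sw t (fun p q' => sw q' (fun q y => phi (S q ** y ** v) *: p))).
  apply: eq_sw => p q'.
  have lF : lin (fun z => phi (z ** v) *: p).
    apply: lin_scalel; exact: lin_compA (lin_mull H v) lphi.
  rewrite -(sw_lin H _ _ lF) (sw_antil hH) mulZH (mul1H hH) scalerA; congr (_ *: _).
  exact: esym (linZ (eps q') v lphi).
rewrite -(swA hH t (fun p q y => phi (S q ** y ** v) *: p)) (swC hH).
rewrite -(swA hH t (fun y p q => phi (S q ** y ** v) *: p)).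
transitivity (sw t (fun x q => \sum_j phi (S q ** (e j ** v)) *: sw x (fun y p => y 0 j *: p))).
  apply: eq_sw => x q.
  transitivity (sw x (fun y p => \sum_j phi (S q ** (e j ** v)) *: (y 0 j *: p))).
    apply: eq_sw => y p; rewrite (lin_expand y (F := fun y => phi (S q ** y ** v) : k^o)).
      rewrite scaler_suml; apply: eq_bigr => j _; rewrite (mulHA hH) [RHS]scalerA.
      by rewrite [RHS](congr1 (fun c => c *: p) (mulrC _ _)).
    exact: lin_compA (lin_mulr H _) (lin_compA (lin_mull H v) lphi).
  rewrite {1}/sweedler; under eq_bigr do under eq_bigr do rewrite scaler_sumr.
  under eq_bigr do rewrite exchange_big; rewrite exchange_big /=.
  apply: eq_bigr => j _; rewrite -sw_scale; apply: eq_bigr => a _; exact: eq_bigr.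
rewrite {1}/sweedler; under eq_bigr do under eq_bigr do rewrite scaler_sumr.
under eq_bigr do rewrite exchange_big; rewrite exchange_big /=.
apply: eq_bigr => j _; rewrite (sw_lin H _ _ (lin_sw H _)).
apply: eq_bigr => a _; apply: eq_bigr => b _; congr (_ *: _).
by rewrite (linZ _ _ (lin_sw H _)).
Qed.

(* The map t (x) phi |-> phi (S t_(2)) t_(1), from the integrals tensored with A^* to A, is injective. *)
Lemma integrals_rank r (K : 'M[k]_(r, d)) : row_free K ->
  (forall i, integral H (row i K)) -> (d * r <= d)%N.
Proof.
move=> fK iK.
(* Column [i] of [Phi] is a functional on A, paired with the integral in row [i] of [K]; so [Phi]
   encodes a tensor. *)
pose phi (Phi : 'M[k]_(d, r)) i (z : A) : k := (z *m Phi) 0 i.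
have lphi Phi i : lin (phi Phi i : A -> k^o).
  by move=> c u v; rewrite /phi mulmxDl -scalemxAl !mxE.
pose Theta Phi := \sum_i sw (row i K) (fun p q => phi Phi i (S q) *: p).
have Theta_inj Phi : Theta Phi = 0 -> Phi = 0.
  move=> Th0.
  (* Left multiplication of [Theta Phi] by [w] moves into the argument of the functionals, because
     the rows of [K] are integrals. *)
  have star w : \sum_i sw (row i K) (fun p q => phi Phi i (S q ** w) *: p) = 0.
    transitivity (w ** Theta Phi); last by rewrite Th0 mulH0.
    rewrite /Theta (lin_sum _ _ _ (lin_mulr H w)); apply: eq_bigr => i _.
    rewrite -(sw_integral w (F := fun p z => phi Phi i z *: p)) //.
      rewrite (sw_lin H _ _ (lin_mulr H w)); apply: eq_sw => p q.
      by rewrite mulHZ.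
    split=> z; [exact: lin_scale | exact: lin_scalel].
  have /eqP : Phi *m K = 0.
    apply/row_matrixP => j; rewrite row0 rowE mulmxA mulmx_sum_row.
    rewrite (eq_bigr _ (fun i _ => integral_reconstruction (row i K) (delta_mx 0 j) (lphi Phi i))).
    rewrite exchange_big big1 //= => l _.
    by rewrite -(lin_sum _ _ _ (lin_sw H _)) star (lin0 (lin_sw H _)).
  by rewrite mulmx_free_eq0 // => /eqP.
pose T := linmx (fun v => Theta (vec_mx v)).
have lT : lin (fun v => Theta (vec_mx v)).
  apply: lin_sumF => i; apply: lin_swF => p q; apply: lin_scalel => c u v.
  by rewrite /phi linearP mulmxDr -scalemxAr !mxE.
have fT : row_free T.
  rewrite -kermx_eq0; apply/eqP/row_matrixP => i; rewrite row0.
  have /sub_kermxP : (row i (kermx T) <= kermx T)%MS by exact: row_sub.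
  rewrite mul_linmx // => /Theta_inj/(canRL vec_mxK) ->.
  by rewrite linear0.
by rewrite -(eqP fT) rank_leq_col.
Qed.

End Integrals.

(** * Uniqueness of the integral and the Frobenius form *)

Section Frobenius.
Variables (k : fieldType) (d : nat) (H : hopf_data k d).
Hypotheses (hH : is_cocomm_hopf H) (hloc : local_alg H).
Local Notation A := 'rV[k]_d.
Local Notation e := (@basis_el k d).
Local Notation eps := (counitH H).
Local Notation "1H" := (hunit H).
Local Notation "x ** y" := (mulH H x y) (at level 40, left associativity).

Lemma hopf_dim_gt0 : (0 < d)%N.
Proof.
rewrite lt0n; apply/eqP => d0; have := hunit_neq0 hH; case/eqP; apply/rowP => i.
by have := ltn_ord i; rewrite [X in (_ < X)%N]d0.
Qed.

(** Two independent integrals would give [2 d <= d]. *)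
Lemma integral_proportional x y : integral H x -> integral H y -> x != 0 ->
  exists c, y = c *: x.
Proof.
move=> ix iy x0; have [/sub_rVP[c hc]|nyx] := boolP (y <= x)%MS; first by exists c.
have : row_free (col_mx x y).
  have : (\rank x < \rank (x + y))%N.
    rewrite (ltn_leqif (mxrank_leqif_sup (addsmxSl x y))).
    by apply: contra nyx => h; apply: submx_trans h; exact: addsmxSr.
  by rewrite rank_rV x0 addsmxE /row_free eqn_leq rank_leq_row.
move/(integrals_rank hH) => hr; have: (d * (1 + 1) <= d)%N.
  apply: hr => i; case: (splitP i) => j hj.
    have -> : i = lshift 1 j by apply: val_inj.
    by rewrite rowKu (ord1 j) row_id.
  have -> : i = rshift 1 j by apply: val_inj.
  by rewrite rowKd (ord1 j) row_id.
by rewrite leqNgt -{1}[d]muln1 ltn_mul2l hopf_dim_gt0.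
Qed.

Definition gram (lam : 'cV[k]_d) : 'M[k]_d := \matrix_(i, j) ((e i ** e j) *m lam) 0 0.

Lemma mul_gram lam a b : a *m gram lam *m b^T = (a ** b) *m lam.
Proof.
have lF z : lin (fun y => (z ** y) *m lam).
  exact: lin_compA (lin_mulr H z) (lin_mulmxl lam).
have lG z : lin (fun y => (y ** z) *m lam).
  exact: lin_compA (lin_mull H z) (lin_mulmxl lam).
rewrite (lin_expand a (lG b)) (mulmx_sum_row a) mulmx_suml; apply: eq_bigr => i _.
rewrite -scalemxAl; congr (_ *: _); rewrite (lin_expand b (lF (e i))).
apply/matrixP => u v; rewrite !ord1 !mxE summxE; apply: eq_bigr => j _.
by rewrite !mxE mulrC.
Qed.

(** Any functional with [lam(s) = 1] works: the radical of the form is a left ideal, so if it were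
    nonzero it would contain a nonzero integral [c s], but [lam(c s) = 0] gives [c = 0]. *)
Lemma frobenius_form : exists s lam,
  [/\ integral H s, forall u, s ** u = eps u *: s, s *m lam = 1%:M & gram lam \in unitmx].
Proof.
have [||s [_ s0 is_]] := @left_ideal_integral _ _ H hH hloc 1%:M.
- by move=> a x _; exact: submx1.
- by rewrite -mxrank_eq0 mxrank1 -lt0n hopf_dim_gt0.
have [j sj] : exists j, s 0 j != 0.
  apply: NNPP => hn; case/eqP: s0; apply/rowP => j; rewrite mxE; apply/eqP.
  by apply: contra_notT hn => hj; exists j.
pose lam : 'cV[k]_d := (s 0 j)^-1 *: delta_mx j 0.
exists s, lam.
have slam : s *m lam = 1%:M.
  apply/matrixP => u v; rewrite !ord1 /lam -scalemxAr -colE !mxE eqxx.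
  by rewrite mulVf.
split=> // [u|].
  (* [s u] is again a left integral, hence some [c s]; then [s (u - c) = 0], so [u - c] is not a
     unit and [eps u = c]. *)
  have [|c hc] := integral_proportional is_ _ s0 (y := s ** u).
    by move=> a; rewrite -(mulHA hH) is_ mulZH.
  have hs : s ** (u - c *: 1H) = 0 by rewrite mulHD mulHN mulHZ (mulH1 hH) hc subrr.
  have [he|/(eps_neq0_unit hH hloc)[v [_ hv]]] := eqVneq (eps (u - c *: 1H)) 0.
    by rewrite hc; congr (_ *: _); apply/esym/eqP; rewrite -subr_eq0 -he epsB epsZ (eps1 hH) mulr1.
  by case/eqP: s0; rewrite -[s](mulH1 hH) -hv -(mulHA hH) hs mul0H.
(* Elements of A are rows, so the kernel of the transpose is the radical in the second argument,
   which is a left ideal. *)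
rewrite -unitmx_tr -row_free_unit -kermx_eq0; apply: contraT => nk.
have kerP x : (x <= kermx (gram lam)^T)%MS <-> forall a, (a ** x) *m lam = 0.
  split=> [/sub_kermxP hx a|hx].
    by rewrite -mul_gram -mulmxA -[_ *m x^T]trmxK trmx_mul trmxK hx trmx0 mulmx0.
  apply/sub_kermxP/trmx_inj; rewrite trmx_mul trmxK trmx0; apply/row_matrixP => i.
  by rewrite rowE mulmxA mul_gram hx row0.
have [|x [/kerP xK x0 ix]] := @left_ideal_integral _ _ H hH hloc _ _ nk.
  by move=> a x /kerP hx; apply/kerP => b; rewrite -(mulHA hH).
have [c hc] := integral_proportional is_ ix s0.
move: (xK 1H); rewrite (mul1H hH) hc -scalemxAl slam => /matrixP/(_ 0 0).
rewrite !mxE eqxx mulr1 => c0; case/eqP: x0.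
by rewrite hc c0 scale0r.
Qed.

End Frobenius.

(** * Intertwiners, direct sums and split submodules *)

Section Modules.
Variables (k : fieldType) (d : nat) (H : hopf_data k d).
Local Notation A := 'rV[k]_d.
Local Notation e := (@basis_el k d).
Local Notation hmod := (hmod k d).

Definition inter (M N : hmod) (T : 'M[k]_(hdim N, hdim M)) : Prop :=
  forall i, T *m hact M i = hact N i *m T.

Lemma inter_rho M N T x : @inter M N T -> T *m rho M x = rho N x *m T.
Proof.
move=> hT; rewrite /rho mulmx_sumr mulmx_suml; apply: eq_bigr => i _.
by rewrite -scalemxAr -scalemxAl hT.
Qed.

Lemma rho_inter M N T : (forall x, T *m rho M x = rho N x *m T) -> @inter M N T.
Proof. by move=> hT i; have := hT (e i); rewrite !rho_basis. Qed.

Lemma inter1 M : @inter M M 1%:M.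
Proof. by move=> i; rewrite mul1mx mulmx1. Qed.

Lemma inter_comp M N L T U : @inter M N T -> @inter N L U -> @inter M L (U *m T).
Proof. by move=> hT hU i; rewrite -mulmxA hT !mulmxA hU. Qed.

Lemma interD M N T U : @inter M N T -> @inter M N U -> @inter M N (T + U).
Proof. by move=> hT hU i; rewrite mulmxDl mulmxDr hT hU. Qed.

Lemma interN M N T : @inter M N T -> @inter M N (- T).
Proof. by move=> hT i; rewrite mulNmx mulmxN hT. Qed.

Lemma inter_inv M N T U : @inter M N T -> T *m U = 1%:M -> U *m T = 1%:M -> @inter N M U.
Proof.
move=> hT TU UT i; rewrite -[U *m _]mulmx1 -TU mulmxA -(mulmxA U) -hT.
by rewrite !mulmxA UT mul1mx.
Qed.

Lemma mod_iso_refl (M : hmod) : mod_iso M M.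
Proof. by exists 1%:M, 1%:M; split; rewrite ?mulmx1 //; exact: inter1. Qed.

Lemma mod_iso_sym (M N : hmod) : mod_iso M N -> mod_iso N M.
Proof. by move=> [T [U [TU UT hT]]]; exists U, T; split=> //; exact: inter_inv hT TU UT. Qed.

Lemma mod_iso_trans (M N L : hmod) : mod_iso M N -> mod_iso N L -> mod_iso M L.
Proof.
move=> [T [U [TU UT hT]]] [T' [U' [TU' UT' hT']]]; exists (T' *m T), (U *m U'); split.
- by rewrite mulmxA -(mulmxA T') TU mulmx1.
- by rewrite mulmxA -(mulmxA U) UT' mulmx1.
exact: inter_comp hT hT'.
Qed.

Lemma mod_iso_dim (M N : hmod) : mod_iso M N -> hdim M = hdim N.
Proof.
move=> [T [U [TU UT _]]]; apply/eqP; rewrite eqn_leq.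
by rewrite (mulmx1_min UT) (mulmx1_min TU).
Qed.

Lemma mod_iso_rank (M N : hmod) x : mod_iso M N -> \rank (rho M x) = \rank (rho N x).
Proof.
have le (M' N' : hmod) : mod_iso M' N' -> (\rank (rho M' x) <= \rank (rho N' x))%N.
  move=> [T [U [TU UT hT]]].
  have -> : rho M' x = U *m (rho N' x *m T) by rewrite -inter_rho // mulmxA UT mul1mx.
  apply: leq_trans (mxrankM_maxr _ _) _; exact: mxrankM_maxl.
by move=> h; apply/eqP; rewrite eqn_leq !le //; exact: mod_iso_sym.
Qed.

Lemma mod_iso_module (M N : hmod) : mod_iso M N -> is_module H M -> is_module H N.
Proof.
move=> [T [U [TU UT hT]]] [h1 hM].
have E x : rho N x = T *m rho M x *m U by rewrite (inter_rho _ hT) -mulmxA TU mulmx1.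
split=> [|x y]; first by rewrite E h1 mulmx1.
by rewrite !E hM !mulmxA -(mulmxA _ U) UT mulmx1.
Qed.

Lemma rho_dsum (M N : hmod) x : rho (dsum_mod M N) x = block_mx (rho M x) 0 0 (rho N x).
Proof.
rewrite {1}/rho /=; pose B (X : 'M[k]_(hdim M)) (Y : 'M[k]_(hdim N)) := block_mx X 0 0 Y.
have : forall r : seq 'I_d, \sum_(i <- r) x 0 i *: B (hact M i) (hact N i) =
    B (\sum_(i <- r) x 0 i *: hact M i) (\sum_(i <- r) x 0 i *: hact N i).
  elim=> [|i r IH]; first by rewrite !big_nil /B block_mx0.
  by rewrite !big_cons IH /B scale_block_mx add_block_mx !scaler0 !addr0.
exact.
Qed.

Lemma dsum_module (M N : hmod) : is_module H (dsum_mod M N) <-> is_module H M /\ is_module H N.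
Proof.
split=> [[h1 hM]|[[h1 hM] [h1' hN]]].
  move: h1; rewrite rho_dsum /= (scalar_mx_block (hdim M) (hdim N)).
  case/eq_block_mx => hM1 _ _ hN1.
  split; split=> // x y; have := hM x y; rewrite !rho_dsum mulmx_block !mul0mx !mulmx0 !addr0 !add0r.
    by case/eq_block_mx.
  by case/eq_block_mx.
split=> [|x y]; first by rewrite rho_dsum h1 h1' -scalar_mx_block.
by rewrite !rho_dsum mulmx_block !mul0mx !mulmx0 !addr0 !add0r hM hN.
Qed.

Lemma rank_dsum (M N : hmod) x :
  \rank (rho (dsum_mod M N) x) = (\rank (rho M x) + \rank (rho N x))%N.
Proof. by rewrite rho_dsum rank_diag_block_mx. Qed.

Lemma mod_iso_dsum (M M' N N' : hmod) : mod_iso M M' -> mod_iso N N' ->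
  mod_iso (dsum_mod M N) (dsum_mod M' N').
Proof.
move=> [T [U [TU UT hT]]] [T' [U' [TU' UT' hT']]].
exists (block_mx T 0 0 T'), (block_mx U 0 0 U'); split.
- by rewrite mulmx_block !mul0mx !mulmx0 !addr0 !add0r TU TU' -scalar_mx_block.
- by rewrite mulmx_block !mul0mx !mulmx0 !addr0 !add0r UT UT' -scalar_mx_block.
by move=> i; rewrite /= !mulmx_block !mul0mx !mulmx0 !addr0 !add0r hT hT'.
Qed.

Lemma trmx_vec_inj m n (B C : 'M[k]_(m, n)) : (forall a : 'rV_n, B *m a^T = C *m a^T) -> B = C.
Proof.
move=> h; apply/trmx_inj/row_matrixP => i; rewrite !rowE; apply: trmx_inj.
by rewrite !trmx_mul !trmxK.
Qed.

(** The complement is the image of the idempotent intertwiner [E = 1 - iota pi]. Its coordinates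
    come from a full-rank factorization [E = cb rb], where [E E = E] cancels to [rb cb = 1]. *)
Lemma mod_split (X P : hmod) iota pi : @inter P X iota -> @inter X P pi -> pi *m iota = 1%:M ->
  exists X', mod_iso X (dsum_mod P X').
Proof.
move=> hi hp pii; pose E := 1%:M - iota *m pi.
have EE : E *m E = E.
  rewrite {1}/E mulmxBl mul1mx /E mulmxBr mulmx1 -(mulmxA iota) (mulmxA pi) pii mul1mx.
  by rewrite subrr subr0.
have piE : pi *m E = 0 by rewrite mulmxBr mulmx1 mulmxA pii mul1mx subrr.
have Ei : E *m iota = 0 by rewrite mulmxBl mul1mx -mulmxA pii mulmx1 subrr.
have hE : @inter X X E.
  by apply: interD; [exact: inter1 | apply: interN; exact: inter_comp hp hi].
have EB := mulmx_base E.
have rbI (m : nat) (B : 'M_(m, _)) : B *m row_base E = 0 -> B = 0.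
  by move=> h; apply: (row_free_inj (row_base_free E)); rewrite /= h mul0mx.
have cbI (m : nat) (B : 'M_(_, m)) : col_base E *m B = 0 -> B = 0.
  move=> h; apply: trmx_inj; apply: (row_free_inj (A := (col_base E)^T)).
    by rewrite /row_free mxrank_tr; exact: col_base_full.
  by rewrite -trmx_mul h !trmx0 mul0mx.
move: (col_base E) (row_base E) EB rbI cbI => cb rb EB rbI cbI.
have rc : rb *m cb = 1%:M.
  apply/eqP; rewrite -subr_eq0; apply/eqP/rbI/cbI.
  by rewrite mulmxBl mul1mx mulmxBr !mulmxA EB -mulmxA EB EE subrr.
exists (@HMod k d (\rank E) (fun i => rb *m hact X i *m cb)).
exists (col_mx pi (rb)), (row_mx iota (cb)); split.
- rewrite mul_col_row pii rc (rbI _ (pi *m cb)); last by rewrite -mulmxA EB piE.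
  rewrite (cbI _ (rb *m iota)); last by rewrite mulmxA EB Ei.
  by rewrite -scalar_mx_block.
- by rewrite mul_row_col EB addrC subrK.
move=> i /=; rewrite mul_col_mx mul_block_col !mul0mx addr0 add0r hp; congr col_mx.
rewrite -mulmxA EB -mulmxA -hE; apply/eqP; rewrite -subr_eq0; apply/eqP/cbI.
by rewrite mulmxBr !mulmxA EB EE subrr.
Qed.

End Modules.

(** * Isomorphisms that only reindex bases; associativity of direct sums *)

Section Bijections.
Variables (k : fieldType) (d : nat).
Local Notation hmod := (hmod k d).

(** Most canonical isomorphisms below merely rename basis vectors; each then needs only a bijection
    of indices and an equality of entries. *)
Lemma mod_iso_bij m n (X : 'I_d -> 'M[k]_m) (Y : 'I_d -> 'M[k]_n) (f : 'I_m -> 'I_n) g :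
  cancel f g -> cancel g f -> (forall i a b, Y i (f a) (f b) = X i a b) ->
  mod_iso (HMod X) (HMod Y).
Proof.
move=> fK gK fact.
exists (\matrix_(r, c) (r == f c)%:R), (\matrix_(r, c) (f r == c)%:R); split.
- apply/matrixP => r c; rewrite !mxE (bigD1 (g r)) //= big1 => [|j jr]; rewrite !mxE ?gK ?eqxx ?mul1r.
    by rewrite addr0.
  case: eqP => [rj|]; last by rewrite mul0r.
  by move: jr; rewrite rj fK eqxx.
- apply/matrixP => r c; rewrite !mxE (bigD1 (f r)) //= big1 => [|j /negPf jr]; rewrite !mxE.
    by rewrite eqxx mul1r addr0 (can_eq fK).
  by rewrite eq_sym jr mul0r.
move=> i; apply/matrixP => r c; rewrite !mxE (bigD1 (g r)) //= big1 => [|j jr]; rewrite !mxE.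
  rewrite (bigD1 (f c)) //= big1 => [|j /negPf jc]; rewrite !mxE.
    by rewrite gK !eqxx mul1r mulr1 !addr0 -fact gK.
  by rewrite jc mulr0.
by case: eqP => [rj|]; [move: jr; rewrite rj fK eqxx | rewrite mul0r].
Qed.

Lemma block_diagE m n (X : 'M[k]_m) (Y : 'M[k]_n) r s : block_mx X 0 0 Y r s =
  match split r, split s with
  | inl a, inl b => X a b
  | inr a, inr b => Y a b
  | _, _ => 0 end.
Proof. by rewrite mxE; case: (split r) => a; rewrite mxE; case: (split s) => b; rewrite ?mxE. Qed.

Lemma split_lshift m n (a : 'I_m) : split (lshift n a) = inl a.
Proof. exact: (unsplitK (inl a)). Qed.

Lemma split_rshift m n (a : 'I_n) : split (rshift m a) = inr a.
Proof. exact: (unsplitK (inr a)). Qed.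

Definition split_shift := (split_lshift, split_rshift).

Lemma dsum_assoc (M N L : hmod) :
  mod_iso (dsum_mod M (dsum_mod N L)) (dsum_mod (dsum_mod M N) L).
Proof.
case: M N L => [m X] [n Y] [l Z].
pose f (r : 'I_(m + (n + l))) : 'I_(m + n + l) :=
  match split r with
  | inl a => lshift _ (lshift _ a)
  | inr b => match split b with inl b' => lshift _ (rshift _ b') | inr c => rshift _ c end end.
pose g (r : 'I_(m + n + l)) : 'I_(m + (n + l)) :=
  match split r with
  | inr c => rshift _ (rshift _ c)
  | inl b => match split b with inl a => lshift _ a | inr b' => rshift _ (lshift _ b') end end.
apply: (mod_iso_bij (f := f) (g := g)) => /=.
- move=> r; rewrite /f /g; case: (split_ordP r) => a ->; rewrite ?split_shift //.
  by case: (split_ordP a) => b ->; rewrite !split_shift.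
- move=> r; rewrite /f /g; case: (split_ordP r) => a ->; rewrite ?split_shift //.
  by case: (split_ordP a) => b ->; rewrite !split_shift.
move=> i r s; rewrite /f !block_diagE.
case: (split r) => a; case: (split s) => b; rewrite ?split_shift ?block_diagE;
  try case: (split a) => a'; try case: (split b) => b';
  by rewrite ?split_shift ?block_diagE ?split_shift.
Qed.

Lemma dsum0 (M : hmod) : mod_iso (dsum_mod (zero_mod k d) M) M.
Proof.
case: M => m X; apply: (mod_iso_bij (f := id : 'I_(0 + m) -> 'I_m) (g := id)) => // i a b.
have E (r : 'I_(0 + m)) : split r = inr r.
  case: (split_ordP r) => [[]//|c hc]; by congr inr; apply: val_inj; rewrite hc.
by rewrite block_diagE (E a) (E b).
Qed.

End Bijections.

(** * Free modules: cancellation, and splitting off by means of the integral *)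

Section Free.
Variables (k : fieldType) (d : nat) (H : hopf_data k d).
Hypotheses (hH : is_cocomm_hopf H).
Local Notation A := 'rV[k]_d.
Local Notation e := (@basis_el k d).
Local Notation eps := (counitH H).
Local Notation "1H" := (hunit H).
Local Notation "x ** y" := (mulH H x y) (at level 40, left associativity).
Local Notation hmod := (hmod k d).
Local Notation reg := (reg_mod H).
Local Notation free := (free_mod H).

Lemma rho_reg x y : rho reg x *m y^T = (x ** y)^T.
Proof.
apply: trmx_inj; rewrite trmx_mul !trmxK -(mul_linmx y (lin_mulr H x)); congr (_ *m _).
apply/row_matrixP => i; rewrite rowK (lin_expand x (lin_mull H (e i))).
apply/rowP => j; rewrite !mxE !summxE; apply: eq_bigr => l _.
by rewrite !mxE mulH_basis.
Qed.

Lemma rho_triv x : rho (triv_mod H) x = (eps x)%:M.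
Proof. by rewrite /rho /counitH raddf_sum; apply: eq_bigr => i _ /=; rewrite scale_scalar_mx. Qed.

Lemma reg_endoE (U : 'M[k]_d) : inter (M := reg) (N := reg) U ->
  forall a : A, U *m a^T = (a ** (U *m 1H^T)^T)^T.
Proof.
move=> hU a; rewrite -rho_reg trmxK mulmxA -(inter_rho a hU) -mulmxA rho_reg.
by rewrite (mulH1 hH).
Qed.

(** An intertwiner [U] of the regular module is right multiplication by [U(1)]; this carries the
    counit over to such endomorphisms, which form the opposite algebra of A. *)
Definition endo_eps (U : 'M[k]_d) : k := eps (U *m 1H^T)^T.

Lemma endo_epsD U V : endo_eps (U + V) = endo_eps U + endo_eps V.
Proof. by rewrite /endo_eps mulmxDl linearD epsD. Qed.

Lemma endo_epsM (U V : 'M[k]_d) : inter (M := reg) (N := reg) U ->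
  endo_eps (U *m V) = endo_eps V * endo_eps U.
Proof.
move=> hU; rewrite /endo_eps -mulmxA; have := reg_endoE hU (V *m 1H^T)^T.
by rewrite trmxK => ->; rewrite trmxK (epsM hH).
Qed.

Lemma endo_eps1 : endo_eps 1%:M = 1.
Proof. by rewrite /endo_eps mul1mx trmxK (eps1 hH). Qed.

Hypothesis hloc : local_alg H.

Lemma reg_endo_unit U : inter (M := reg) (N := reg) U -> endo_eps U != 0 -> U \in unitmx.
Proof.
move=> hU /(eps_neq0_unit hH hloc)[v [hv _]].
have : U *m (linmx (fun x => x ** v))^T = 1%:M.
  apply: trmx_vec_inj => a; rewrite -mulmxA -trmx_mul (mul_linmx a (lin_mull H v)).
  by rewrite (reg_endoE hU) (mulHA hH) hv (mulH1 hH) mul1mx.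
by case/mulmx1_unit.
Qed.

Lemma comm_invmx n (U B : 'M[k]_n) : U \in unitmx -> U *m B = B *m U ->
  invmx U *m B = B *m invmx U.
Proof. by move=> uU UB; rewrite -[B in LHS](mulmxK uU) -UB -!mulmxA mulKmx. Qed.

(** [a - c u^-1 b] is the Schur complement of the corner [u] of [T]; its inverse is the opposite
    corner [a'] of [U]. *)
Lemma cancel_unit_block (X Y : hmod) (T : 'M[k]_(d + hdim Y, d + hdim X)) U :
  inter (M := dsum_mod reg X) (N := dsum_mod reg Y) T -> T *m U = 1%:M -> U *m T = 1%:M ->
  ulsubmx T \in unitmx -> mod_iso X Y.
Proof.
rewrite -(submxK T) -(submxK U) block_mxKul.
move: (ulsubmx T) (ursubmx T) (dlsubmx T) (drsubmx T) => u b c a.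
move: (ulsubmx U) (ursubmx U) (dlsubmx U) (drsubmx U) => u' b' c' a' hT.
rewrite !mulmx_block (scalar_mx_block d) (scalar_mx_block d).
case/eq_block_mx => _ ub _ cb; case/eq_block_mx => _ _ cu ca uu.
exists (a - c *m invmx u *m b), a'; split.
- have : b *m a' = - (u *m b') by apply/eqP; rewrite -addr_eq0 addrC ub.
  move=> h; rewrite mulmxBl -!mulmxA h !mulmxN mulKmx // opprK addrC.
  exact: cb.
- have : a' *m c = - (c' *m u) by apply/eqP; rewrite -addr_eq0 addrC cu.
  by move=> h; rewrite mulmxBr !mulmxA h mulNmx mulmxK // mulNmx opprK addrC.
move=> i; have := hT i; rewrite /= !mulmx_block !mul0mx !mulmx0 !addr0 !add0r.
case/eq_block_mx => hu hb hc ha.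
have hu' := comm_invmx uu hu.
by rewrite mulmxBl mulmxBr ha -!mulmxA hb !mulmxA -(mulmxA c) hu' !mulmxA hc.
Qed.

(* If the corner [u] of the isomorphism is not invertible, then shearing it by the
   corner [b'] of the inverse makes it so, because u' u + b' c = 1. *)
Lemma cancel_reg (X Y : hmod) : mod_iso (dsum_mod reg X) (dsum_mod reg Y) -> mod_iso X Y.
Proof.
move=> [T [U [TU UT hT]]]; have hU := inter_inv hT TU UT.
rewrite /= in T U TU UT hT hU.
have [eu|eu] := eqVneq (endo_eps (ulsubmx T)) 0; last first.
  apply: (cancel_unit_block hT TU UT); apply: reg_endo_unit => // i.
  have := hT i; rewrite -(submxK T) /= !mulmx_block !mul0mx !mulmx0 !addr0 !add0r.
  by case/eq_block_mx; rewrite block_mxKul.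
move: TU UT hT hU eu; rewrite -(submxK T) -(submxK U) block_mxKul.
move: (ulsubmx T) (ursubmx T) (dlsubmx T) (drsubmx T) => u b c a.
move: (ulsubmx U) (ursubmx U) (dlsubmx U) (drsubmx U) => u' b' c' a'.
move=> TU UT hT hU eu.
have hT' i : [/\ u *m hact reg i = hact reg i *m u, b *m hact X i = hact reg i *m b,
    c *m hact reg i = hact Y i *m c & a *m hact X i = hact Y i *m a].
  have := hT i; rewrite /= !mulmx_block !mul0mx !mulmx0 !addr0 !add0r.
  by case/eq_block_mx.
have hU' i : [/\ u' *m hact reg i = hact reg i *m u' & b' *m hact Y i = hact reg i *m b'].
  have := hU i; rewrite /= !mulmx_block !mul0mx !mulmx0 !addr0 !add0r.
  by case/eq_block_mx.
have uu : u' *m u + b' *m c = 1%:M.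
  by move: UT; rewrite mulmx_block (scalar_mx_block d); case/eq_block_mx.
(* After this shear the corner is [u + b' c]; as the counit of [u] vanishes, that of the new corner
   equals the counit of [u' u + b' c = 1]. *)
pose R : 'M[k]_(d + hdim Y) := block_mx 1%:M b' 0 1%:M.
pose R' : 'M[k]_(d + hdim Y) := block_mx 1%:M (- b') 0 1%:M.
have RR' : R *m R' = 1%:M.
  rewrite mulmx_block !mul1mx !mulmx1 !mul0mx !mulmx0 !addr0 !add0r addNr.
  by rewrite -scalar_mx_block.
have R'R : R' *m R = 1%:M by apply: mulmx1C.
apply: (@cancel_unit_block X Y (R *m block_mx u b c a) (block_mx u' b' c' a' *m R')).
- move=> i; rewrite -mulmxA hT !mulmxA; congr (_ *m _).
  rewrite /= !mulmx_block !mul1mx !mulmx1 !mul0mx !mulmx0 !addr0 !add0r.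
  by have [_ ->] := hU' i.
- by rewrite mulmxA -(mulmxA R) TU mulmx1.
- by rewrite mulmxA -(mulmxA _ R') R'R mulmx1.
rewrite mulmx_block block_mxKul mul1mx; apply: reg_endo_unit.
  move=> i; have [hu _ hc _] := hT' i; have [_ hb] := hU' i.
  by rewrite mulmxDl mulmxDr hu -mulmxA hc !mulmxA hb.
have hu' : inter (M := reg) (N := reg) u' by move=> i; have [] := hU' i.
have := congr1 endo_eps uu; rewrite endo_epsD endo_epsM // eu mul0r add0r endo_eps1.
by rewrite endo_epsD eu add0r => ->; exact: oner_neq0.
Qed.

Lemma cancel_free m (X Y : hmod) : mod_iso (dsum_mod (free m) X) (dsum_mod (free m) Y) -> mod_iso X Y.
Proof.
elim: m => [|m IH] /= h.
  by apply: mod_iso_trans (dsum0 Y); apply: mod_iso_trans h; apply: mod_iso_sym; exact: dsum0.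
apply/IH/cancel_reg; apply: mod_iso_trans (dsum_assoc _ _ _) _; apply: (mod_iso_trans h).
by apply: mod_iso_sym; exact: dsum_assoc.
Qed.

(** If [x] acts by the scalar [c], then [x - c] acts by zero and is not a unit; in a local algebra
    this forces [eps x = c]. *)
Lemma dim1_triv (X : hmod) : is_module H X -> hdim X = 1%N -> mod_iso X (triv_mod H).
Proof.
case: X => n a /= hX n1; subst n; move: hX; set X := HMod a => hX.
have rho_scal x : rho X x = (rho X x 0 0)%:M by apply/matrixP => i j; rewrite !ord1 !mxE eqxx.
have E x : rho X x = (eps x)%:M.
  pose c := rho X x 0 0.
  have hc : rho X (x - c *: 1H) = 0.
    rewrite (linD _ _ (lin_rho X)) -scaleN1r !(linZ _ _ (lin_rho X)) hX.1 [rho X x]rho_scal.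
    by rewrite scaleN1r scalemx1 subrr.
  have [he|/(eps_neq0_unit hH hloc)[v [hv _]]] := eqVneq (eps (x - c *: 1H)) 0.
    move/eqP: he; rewrite epsB epsZ (eps1 hH) mulr1 subr_eq0 => /eqP ->.
    exact: rho_scal.
  have := hX.1; rewrite -hv hX.2 hc mulmx0 => /matrixP/(_ 0 0).
  by rewrite !mxE eqxx => /esym/eqP; rewrite oner_eq0.
apply: (mod_iso_bij (f := id) (g := id)) => // i r s /=.
by rewrite -eps_basis -E rho_basis.
Qed.

Section Integral.
Variables (s : A) (lam : 'cV[k]_d).
Hypotheses (s_eps : forall u, s ** u = eps u *: s)
  (slam : s *m lam = 1%:M) (lamU : gram H lam \in unitmx).

(* If l (s x) = 1, the map X -> A representing y |-> (a |-> l (a y)) through the Frobenius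
   form lam retracts a |-> a x up to a unit. *)
Lemma split_reg (X : hmod) : is_module H X -> rho X s != 0 -> exists X', mod_iso X (dsum_mod reg X').
Proof.
move=> hX sX.
have [x [l lsx]] : exists (x : 'cV[k]_(hdim X)) (l : 'rV_(hdim X)), l *m rho X s *m x = 1%:M.
  have [i [j ij]] : exists i j, rho X s i j != 0.
    apply: NNPP => hn; case/eqP: sX; apply/matrixP => i j; rewrite mxE; apply/eqP.
    by apply: contra_notT hn => hj; exists i, j.
  exists ((rho X s i j)^-1 *: delta_mx j 0), (delta_mx 0 i).
  rewrite -scalemxAr -rowE -colE; apply/matrixP => u v.
  by rewrite !ord1 !mxE eqxx mulVf.
pose iota : 'M[k]_(hdim X, d) := (linmx (fun a => (rho X a *m x)^T))^T.
pose Q : 'M[k]_(d, hdim X) := linmx (fun a => l *m rho X a).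
have iotaE a : iota *m a^T = rho X a *m x.
  rewrite -trmx_mul mul_linmx ?trmxK // => c u v.
  by rewrite (lin_rho X) mulmxDl -scalemxAl linearP.
have QE a : a *m Q = l *m rho X a.
  by rewrite mul_linmx // => c u v; rewrite (lin_rho X) mulmxDr -scalemxAr.
have hi : inter (M := reg) (N := X) iota.
  apply: rho_inter => a; apply: trmx_vec_inj => b.
  by rewrite -!mulmxA rho_reg !iotaE hX.2 mulmxA.
pose G := gram H lam.
have [p Gp] : exists p, G *m p = Q by exists (invmx G *m Q); rewrite mulKVmx.
(* Associativity [lam(a (b c)) = lam((a b) c)] as a matrix identity; it makes [p = G^-1 Q] an
   intertwiner. *)
have GR b : G *m rho reg b = linmx (fun a => a ** b) *m G.
  apply: trmx_vec_inj => c; apply/row_matrixP => i; rewrite !rowE -!mulmxA rho_reg !mulmxA.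
  by rewrite (mul_linmx _ (lin_mull H b)) !mul_gram (mulHA hH).
have hp : inter (M := X) (N := reg) p.
  apply: rho_inter => b; apply: (can_inj (mulKmx (lamU : G \in unitmx))); rewrite !mulmxA Gp GR -mulmxA Gp.
  apply/row_matrixP => i; rewrite !rowE !mulmxA (mul_linmx _ (lin_mull H b)) !QE.
  by rewrite hX.2 mulmxA.
pose u := p *m iota.
have hu : inter (M := reg) (N := reg) u by exact: inter_comp hi hp.
have uU : u \in unitmx.
  apply: reg_endo_unit => //.
  (* This value is [lam(s u(1)) = eps(u(1))]; by the choice of [p] it is also [l(s x) = 1]. *)
  have h1 : s *m G *m (u *m 1H^T) = 1%:M.
    rewrite /u -(mulmxA p) iotaE hX.1 mul1mx mulmxA -(mulmxA s) Gp QE.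
    exact: lsx.
  move: h1; rewrite -[u *m _]trmxK mul_gram s_eps -scalemxAl slam => /matrixP/(_ 0 0).
  by rewrite !mxE eqxx mulr1 /endo_eps => ->; exact: oner_neq0.
apply: (@mod_split _ _ X reg iota (invmx u *m p)) => //; last by rewrite -mulmxA mulVmx.
apply: (inter_comp hp); apply: (inter_inv hu); [exact: mulmxV | exact: mulVmx].
Qed.

(** By [s a = eps(a) s] the action is the outer product of the nonzero vector [s] with the
    counit. *)
Lemma rank_reg : \rank (rho reg s) = 1%N.
Proof.
have E : rho reg s = s^T *m (epscol H)^T.
  apply: trmx_vec_inj => a; rewrite rho_reg s_eps -mulmxA -trmx_mul mul_epscol.
  by rewrite tr_scalar_mx mul_mx_scalar linearZ.
apply/eqP; rewrite eqn_leq; apply/andP; split.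
  by rewrite E; apply: leq_trans (mxrankM_maxl _ _) _; exact: rank_leq_col.
rewrite lt0n mxrank_eq0; apply: contraTneq (oner_neq0 k) => h.
have := rho_reg s 1H; rewrite h mul0mx (mulH1 hH) => /(congr1 trmx); rewrite trmxK trmx0 => s0.
move: slam; rewrite -s0 mul0mx => /matrixP/(_ 0 0); rewrite !mxE eqxx => /esym/eqP h0.
by rewrite h0.
Qed.

Lemma rank_free m : \rank (rho (free m) s) = m.
Proof.
elim: m => [|m IH]; last by rewrite (rank_dsum reg (free m)) rank_reg IH.
by apply/eqP; rewrite -leqn0; exact: rank_leq_row.
Qed.

Lemma hdim_free m : hdim (free m) = (m * d)%N.
Proof. by elim: m => //= m ->. Qed.

Lemma split_free m (X : hmod) : is_module H X -> (m <= \rank (rho X s))%N ->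
  exists X', mod_iso X (dsum_mod (free m) X').
Proof.
elim: m X => [|m IH] X hX hm.
  by exists X; apply: mod_iso_sym; exact: dsum0.
have [|X' hX'] := split_reg hX.
  by rewrite -mxrank_eq0 -lt0n; apply: leq_trans hm.
have [_ mX'] := (dsum_module H reg X').1 (mod_iso_module hX' hX).
have [|X'' hX''] := IH _ mX'.
  by move: hm; rewrite (mod_iso_rank s hX') rank_dsum rank_reg.
exists X''; apply: mod_iso_trans hX' _; apply: mod_iso_trans (dsum_assoc _ _ _).
by apply: mod_iso_dsum => //; exact: mod_iso_refl.
Qed.

Lemma rank_dim (X : hmod) : is_module H X -> (\rank (rho X s) * d <= hdim X)%N.
Proof.
move=> hX; have [X' /mod_iso_dim hd] := split_free hX (leqnn _).
by rewrite [leqRHS]hd /= hdim_free leq_addr.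
Qed.

(** On [P (+) Q = A^m] the rank times [d] equals the dimension; on each summand it is at most the
    dimension, so equality holds on both. *)
Lemma projective_rank (P : hmod) : projective_mod H P -> (\rank (rho P s) * d)%N = hdim P.
Proof.
move=> [hP [Q [m [hQ hiso]]]]; apply/eqP; rewrite eqn_leq rank_dim //=.
have := mod_iso_rank s hiso; rewrite rank_dsum rank_free => hr.
have /= := mod_iso_dim hiso; rewrite hdim_free -hr mulnDl => hd.
by rewrite -(leq_add2r (hdim Q)) hd leq_add2l rank_dim.
Qed.

End Integral.
End Free.

(** * Entries and products of Kronecker matrices *)

Section Kronecker.
Variable k : fieldType.

(** Inverse of [mxvec_index]; it turns an entry of [kron] from a fourfold sum into one product. *)
Definition unidx m n (r : 'I_(m * n)) : 'I_m * 'I_n :=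
  enum_val (cast_ord (esym (mxvec_cast m n)) r).

Lemma unidxK m n (r : 'I_(m * n)) : mxvec_index (unidx r).1 (unidx r).2 = r.
Proof. by rewrite /mxvec_index /unidx -surjective_pairing enum_valK cast_ordKV. Qed.

Lemma idxK m n (a : 'I_m) (b : 'I_n) : unidx (mxvec_index a b) = (a, b).
Proof. by rewrite /mxvec_index /unidx cast_ordK enum_rankK. Qed.

Lemma idx1K m n (a : 'I_m) (b : 'I_n) : (unidx (mxvec_index a b)).1 = a.
Proof. by rewrite idxK. Qed.

Lemma idx2K m n (a : 'I_m) (b : 'I_n) : (unidx (mxvec_index a b)).2 = b.
Proof. by rewrite idxK. Qed.

Lemma sum_idx (V : nmodType) m n (F : 'I_(m * n) -> V) :
  \sum_r F r = \sum_a \sum_b F (mxvec_index a b).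
Proof.
rewrite pair_big /= (reindex (fun p : 'I_m * 'I_n => mxvec_index p.1 p.2)) //=.
exists (@unidx m n) => [[a b] _|r _]; [by rewrite idxK | exact: unidxK].
Qed.

Lemma kronE m1 n1 m2 n2 (X : 'M[k]_(m1, n1)) (Y : 'M[k]_(m2, n2)) r s :
  kron X Y r s = X (unidx r).1 (unidx s).1 * Y (unidx r).2 (unidx s).2.
Proof.
rewrite -[in LHS](unidxK r) -[in LHS](unidxK s).
case: (unidx r) (unidx s) => [a b] [c f] /=.
have idx_eq m n (a' a0 : 'I_m) (b' b0 : 'I_n) :
    (mxvec_index a' b' == mxvec_index a0 b0) = (a' == a0) && (b' == b0).
  apply/eqP/andP => [h|[/eqP-> /eqP->]//].
  by have := congr1 (@unidx m n) h; rewrite !idxK => -[-> ->].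
rewrite mxE (bigD1 a) //= [X in _ + X]big1 => [|a' /negPf ha]; last first.
  rewrite big1 // => b' _; rewrite big1 // => c' _; rewrite big1 // => f' _.
  by rewrite idx_eq ha.
rewrite (bigD1 b) //= [X in _ + X + _]big1 => [|b' /negPf hb]; last first.
  by rewrite big1 // => c' _; rewrite big1 // => f' _; rewrite idx_eq hb andbF.
rewrite (bigD1 c) //= [X in _ + X + _ + _]big1 => [|c' /negPf hc]; last first.
  by rewrite big1 // => f' _; rewrite !idx_eq hc andbF.
rewrite (bigD1 f) //= big1 => [|f' /negPf hf]; last by rewrite !idx_eq hf !andbF.
by rewrite !eqxx !addr0.
Qed.

Lemma kronM m1 n1 p1 m2 n2 p2 (X : 'M[k]_(m1, n1)) (X' : 'M[k]_(n1, p1))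
  (Y : 'M[k]_(m2, n2)) (Y' : 'M[k]_(n2, p2)) :
  kron X Y *m kron X' Y' = kron (X *m X') (Y *m Y').
Proof.
apply/matrixP => r s; rewrite kronE !mxE sum_idx mulr_suml; apply: eq_bigr => a _.
by rewrite mulr_sumr; apply: eq_bigr => b _; rewrite !kronE idxK /= mulrACA.
Qed.

Lemma kron1 m n : kron (1%:M : 'M[k]_m) (1%:M : 'M[k]_n) = 1%:M.
Proof.
apply/matrixP => r s; rewrite kronE !mxE -natrM mulnb; congr (_ %:R).
by rewrite -xpair_eqE -!surjective_pairing (can_eq (g := fun p => mxvec_index p.1 p.2)) //
  => t; exact: unidxK.
Qed.

Lemma kronPl m1 n1 m2 n2 c (X X' : 'M[k]_(m1, n1)) (Y : 'M[k]_(m2, n2)) :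
  kron (c *: X + X') Y = c *: kron X Y + kron X' Y.
Proof. by apply/matrixP => r s; rewrite !(kronE, mxE) mulrDl mulrA. Qed.

Lemma kronPr m1 n1 m2 n2 c (X : 'M[k]_(m1, n1)) (Y Y' : 'M[k]_(m2, n2)) :
  kron X (c *: Y + Y') = c *: kron X Y + kron X Y'.
Proof. by apply/matrixP => r s; rewrite !(kronE, mxE) mulrDr mulrCA. Qed.

End Kronecker.

(** * Tensor products and duals of modules; freeness of A (x) M *)

Section Tensor.
Variables (k : fieldType) (d : nat) (H : hopf_data k d).
Local Notation A := 'rV[k]_d.
Local Notation e := (@basis_el k d).
Local Notation eps := (counitH H).
Local Notation S := (antiH H).
Local Notation "1H" := (hunit H).
Local Notation "x ** y" := (mulH H x y) (at level 40, left associativity).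
Local Notation hmod := (hmod k d).
Local Notation reg := (reg_mod H).
Local Notation free := (free_mod H).
Local Notation tensor := (tensor_mod H).
Local Notation sw := (sweedler H).

Lemma tensor_actE (M N : hmod) i r s : hact (tensor M N) i r s =
  \sum_j \sum_l hcomul H i j l *
    (hact M j (unidx r).1 (unidx s).1 * hact N l (unidx r).2 (unidx s).2).
Proof.
rewrite /= summxE; apply: eq_bigr => j _; rewrite summxE; apply: eq_bigr => l _.
by rewrite mxE kronE.
Qed.

Lemma rho_tensor (M N : hmod) x :
  rho (tensor M N) x = sw x (fun a b => kron (rho M a) (rho N b)).
Proof.
rewrite [RHS](lin_expand x (lin_sw H _)); apply: eq_bigr => i _; rewrite sw_basis.
by congr (_ *: _); apply: eq_bigr => j _; apply: eq_bigr => l _; rewrite !rho_basis.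
Qed.

Lemma bilin_kron (M N : hmod) : bilin (fun a b : A => kron (rho M a) (rho N b)).
Proof.
by split=> z c u v; rewrite (lin_rho _) ?kronPl ?kronPr.
Qed.

Lemma tensor_iso (M M' N N' : hmod) : mod_iso M M' -> mod_iso N N' ->
  mod_iso (tensor M N) (tensor M' N').
Proof.
move=> [T [U [TU UT hT]]] [T' [U' [TU' UT' hT']]].
exists (kron T T'), (kron U U'); split; rewrite ?kronM ?TU ?UT ?TU' ?UT' ?kron1 //.
move=> i /=; rewrite mulmx_sumr mulmx_suml; apply: eq_bigr => j _.
rewrite mulmx_sumr mulmx_suml; apply: eq_bigr => l _.
by rewrite -scalemxAr -scalemxAl !kronM hT hT'.
Qed.

Lemma tensor_dsum (M N L : hmod) :
  mod_iso (tensor (dsum_mod M N) L) (dsum_mod (tensor M L) (tensor N L)).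
Proof.
case: M N L => [m X] [n Y] [l Z].
pose f (r : 'I_((m + n) * l)) : 'I_(m * l + n * l) :=
  let: (u, c) := unidx r in
  match split u with inl a => lshift _ (mxvec_index a c) | inr b => rshift _ (mxvec_index b c) end.
pose g (r : 'I_(m * l + n * l)) : 'I_((m + n) * l) :=
  match split r with
  | inl r' => let: (a, c) := unidx r' in mxvec_index (lshift n a) c
  | inr r' => let: (b, c) := unidx r' in mxvec_index (rshift m b) c end.
apply: (mod_iso_bij (f := f) (g := g)).
- move=> r; rewrite /f /g -[in RHS](unidxK r); case: (unidx r) => u c /=.
  by case: (split_ordP u) => a ->; rewrite split_shift idxK.
- move=> r; rewrite /f /g; case: (split_ordP r) => a ->; rewrite -[in RHS](unidxK a);
  by case: (unidx a) => b c; rewrite idxK split_shift.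
move=> i r s; rewrite block_diagE (@tensor_actE (dsum_mod (HMod X) (HMod Y)) (HMod Z)) /f.
case: (unidx r) (unidx s) => [u c] [v c'] /=.
case: (split_ordP u) => a ->; case: (split_ordP v) => b ->; rewrite !split_shift.
- rewrite (@tensor_actE (HMod X) (HMod Z)) !idxK; apply: eq_bigr => j _; apply: eq_bigr => q _ /=.
  by rewrite block_diagE !split_shift.
- rewrite big1 // => j _; rewrite big1 // => q _; by rewrite block_diagE !split_shift mul0r mulr0.
- rewrite big1 // => j _; rewrite big1 // => q _; by rewrite block_diagE !split_shift mul0r mulr0.
rewrite (@tensor_actE (HMod Y) (HMod Z)) !idxK; apply: eq_bigr => j _; apply: eq_bigr => q _ /=.
by rewrite block_diagE !split_shift.
Qed.

Lemma tensor_zero (M : hmod) : mod_iso (tensor (zero_mod k d) M) (zero_mod k d).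
Proof. by apply: (mod_iso_bij (f := id : 'I_(0 * hdim M) -> 'I_0) (g := id)) => // i []. Qed.

Hypothesis hH : is_cocomm_hopf H.

(** The flip of the factors is linear over A by cocommutativity. *)
Lemma tensorC (M N : hmod) : mod_iso (tensor M N) (tensor N M).
Proof.
case: M N => [m X] [n Y].
pose f m n (r : 'I_(m * n)) : 'I_(n * m) := mxvec_index (unidx r).2 (unidx r).1.
have fK m' n' : cancel (f m' n') (f n' m') by move=> r; rewrite /f idxK unidxK.
apply: (mod_iso_bij (f := f m n) (g := f n m)) => // i r s.
rewrite (@tensor_actE (HMod X) (HMod Y)) (@tensor_actE (HMod Y) (HMod X)) /f ?(idx1K, idx2K) exchange_big /=.
by apply: eq_bigr => j _; apply: eq_bigr => l _; rewrite (hcomulC hH) [X in _ * X]mulrC.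
Qed.

Lemma tensorA (M N L : hmod) :
  mod_iso (tensor M (tensor N L)) (tensor (tensor M N) L).
Proof.
case: M N L => [m X] [n Y] [l Z].
pose f (r : 'I_(m * (n * l))) : 'I_(m * n * l) :=
  mxvec_index (mxvec_index (unidx r).1 (unidx (unidx r).2).1) (unidx (unidx r).2).2.
pose g (r : 'I_(m * n * l)) : 'I_(m * (n * l)) :=
  mxvec_index (unidx (unidx r).1).1 (mxvec_index (unidx (unidx r).1).2 (unidx r).2).
apply: (mod_iso_bij (f := f) (g := g)).
- by move=> r; rewrite /f /g !(idx1K, idx2K) !unidxK.
- by move=> r; rewrite /f /g !(idx1K, idx2K) !unidxK.
move=> i r s; rewrite (@tensor_actE (tensor (HMod X) (HMod Y)) (HMod Z)).
rewrite (@tensor_actE (HMod X) (tensor (HMod Y) (HMod Z))) /f ?(idx1K, idx2K).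
pose r1 := (unidx r).1; pose r2 := (unidx (unidx r).2).1; pose r3 := (unidx (unidx r).2).2.
pose s1 := (unidx s).1; pose s2 := (unidx (unidx s).2).1; pose s3 := (unidx (unidx s).2).2.
(* A product of matrix coefficients; [k^o] lets coassociativity in Sweedler form apply to
   scalars. *)
pose G (a b c : A) : k^o :=
  rho (HMod X) a r1 s1 * (rho (HMod Y) b r2 s2 * rho (HMod Z) c r3 s3).
have := swA hH (e i) G; rewrite !sw_basis => h.
transitivity (\sum_j \sum_l0 hcomul H i j l0 *: sw (e j) (fun c f => G c f (e l0))).
  apply: eq_bigr => j _; apply: eq_bigr => q _; congr (_ * _).
  rewrite tensor_actE ?(idx1K, idx2K) sw_basis mulr_suml; apply: eq_bigr => a _.
  rewrite mulr_suml; apply: eq_bigr => b _.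
  by rewrite /G !rho_basis -!mulrA.
rewrite h; apply: eq_bigr => j _; apply: eq_bigr => q _; congr (_ * _).
rewrite tensor_actE sw_basis mulr_sumr; apply: eq_bigr => a _.
rewrite mulr_sumr; apply: eq_bigr => b _.
by rewrite /G !rho_basis [RHS]mulrCA.
Qed.

Lemma triv_tensor (M : hmod) : mod_iso (tensor (triv_mod H) M) M.
Proof.
case: M => [m X].
apply: (mod_iso_bij (f := fun r : 'I_(1 * m) => (unidx r).2) (g := mxvec_index ord0)).
- by move=> r; rewrite -[RHS]unidxK; rewrite [(unidx r).1]ord1; congr mxvec_index; apply: val_inj.
- by move=> r; rewrite idxK.
move=> i r s; rewrite (@tensor_actE (triv_mod H) (HMod X)) exchange_big /=.
rewrite (bigD1 i) //= [X in _ = _ + X]big1 => [|l li].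
  rewrite addr0 (eq_bigr (fun j => (hcounit H j * hcomul H i j i) * X i (unidx r).2 (unidx s).2)).
    by rewrite -mulr_suml (hcounitl hH) eqxx mul1r.
  by move=> j _; rewrite mxE !ord1 mulr1n mulrA [_ * hcounit _ _]mulrC.
rewrite (eq_bigr (fun j => (hcounit H j * hcomul H i j l) * X l (unidx r).2 (unidx s).2)).
  by rewrite -mulr_suml (hcounitl hH) eq_sym (negPf li) mul0r.
by move=> j _; rewrite mxE !ord1 mulr1n mulrA [_ * hcounit _ _]mulrC.
Qed.

(** Stands for the bare vector space underlying a module, to be compared with the module itself
    after tensoring with A. *)
Definition trivn n : hmod := @HMod k d n (fun i => (hcounit H i)%:M).

Lemma rho_trivn n x : rho (trivn n) x = (eps x)%:M.
Proof. by rewrite /rho /counitH raddf_sum; apply: eq_bigr => i _ /=; rewrite scale_scalar_mx. Qed.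

(* The tautological map a (x) v |-> a_(1) (x) a_(2) v, with inverse a (x) v |-> a_(1) (x) S(a_(2)) v. *)
Lemma tensor_identity (M : hmod) : is_module H M -> mod_iso (tensor reg (trivn (hdim M))) (tensor reg M).
Proof.
move=> [M1 MM].
pose n := hdim M.
(* [E a i] sends [e_i] to [a], so [T g] sends [e_i (x) v] to the sum of [a (x) g(b) v] over the legs
   [a], [b] of [e_i]; composing such maps convolves [g] with [h]. *)
pose E (a : A) i : 'M[k]_d := a^T *m e i.
pose T (g : A -> A) := \sum_i sw (e i) (fun a b => kron (E a i) (rho M (g b))).
have TT g h : T g *m T h =
    \sum_i sw (e i) (fun a b => sw a (fun c f => kron (E c i) (rho M (g f ** h b)))).
  rewrite /T mulmx_sumr; apply: eq_bigr => i _.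
  rewrite [in RHS]/sweedler (comul_basis H i) /sweedler comul_basis mulmx_sumr.
  apply: eq_bigr => j _; rewrite mulmx_sumr; apply: eq_bigr => l _.
  rewrite -scalemxAr; congr (_ *: _); rewrite mulmx_suml (bigD1 j) //= [X in _ + X]big1 => [|q qj].
    rewrite addr0 comul_basis mulmx_suml; apply: eq_bigr => a _; rewrite mulmx_suml.
    apply: eq_bigr => b _; rewrite -scalemxAl kronM MM; congr (_ *: kron _ _).
    rewrite /E -!mulmxA; congr (_ *m _); rewrite mulmxA.
    have -> : e j *m (e j)^T = 1%:M by apply/matrixP => u v; rewrite /basis_el trmx_delta mul_delta_mx !ord1 !mxE.
    by rewrite mul1mx.
  rewrite mulmx_suml big1 // => a _; rewrite mulmx_suml big1 // => b _.
  rewrite -scalemxAl kronM /E -mulmxA (mulmxA (e q)) /basis_el !trmx_delta mul_delta_mx_0 //.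
  by rewrite mul0mx mulmx0; apply/matrixP => u v; rewrite mxE kronE !mxE mul0r mulr0.
have lE i (Y : 'M[k]_n) : lin (fun a => kron (E a i) Y).
  by move=> c u v; rewrite /E linearP mulmxDl -scalemxAl kronPl.
have lK m1 m2 (X : 'M[k]_(m1, m2)) : lin (fun b : A => kron X (rho M b)).
  by move=> c u v; rewrite (lin_rho M) kronPr.
have T_inv g h : (forall b, sw b (fun c f => g c ** h f) = eps b *: 1H) -> T g *m T h = 1%:M.
  move=> gh; rewrite TT -[RHS]kron1.
  transitivity (\sum_i kron (E (e i) i) (1%:M : 'M[k]_n)).
    apply: eq_bigr => i _.
    rewrite (swA hH (e i) (fun c f b => kron (E c i) (rho M (g f ** h b)))).
    rewrite -(sw_epsr hH (e i) (lE i 1%:M)); apply: eq_sw => a b.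
    by rewrite -(sw_lin H _ _ (lK _ _ (E a i))) gh (linZ _ _ (lK _ _ _)) M1.
  apply/matrixP => r s; rewrite summxE kronE.
  rewrite (eq_bigr (fun i => E (e i) i (unidx r).1 (unidx s).1 *
    (1%:M : 'M[k]_n) (unidx r).2 (unidx s).2)) => [|i _]; last exact: kronE.
  rewrite -mulr_suml -summxE; congr (_ * _).
  rewrite (_ : \sum_i E (e i) i = 1%:M) // [RHS]scalar_mx_sum_delta; apply: eq_bigr => i _.
  by rewrite /E /basis_el trmx_delta mul_delta_mx scale1r.
have R_entry x i l : rho reg x i l = (x ** e l) 0 i.
  by have /matrixP/(_ i 0) := rho_reg (H := H) x (e l); rewrite /basis_el trmx_delta -colE !mxE.
exists (T id), (T S); split.
- by apply: T_inv => b; exact: (sw_antir hH).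
- by apply: T_inv => b; exact: (sw_antil hH).
apply: (@rho_inter _ _ (tensor reg (trivn n)) (tensor reg M)) => x.
have -> : rho (tensor reg (trivn n)) x = kron (rho reg x) 1%:M.
  rewrite rho_tensor -(sw_epsr hH x (F := fun a => kron (rho reg a) 1%:M)).
    apply: eq_sw => a b; rewrite rho_trivn; apply/matrixP => r s.
    by rewrite [RHS]mxE !kronE mulrCA; congr (_ * _); rewrite !mxE mulr_natr.
  by move=> c u v; rewrite (lin_rho reg) kronPl.
have bF i : bilin (fun a b => kron (E a i) (rho M b)) by split=> b.
(* Both composites send [e_l (x) v] to the sum of [a (x) b v] over the legs [a], [b] of [x e_l]. *)
transitivity (\sum_l sw (x ** e l) (fun a b => kron (E a l) (rho M b))).
  rewrite mulmx_suml.
  transitivity (\sum_i \sum_l (x ** e l) 0 i *: sw (e i) (fun a b => kron (E a l) (rho M b))).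
    apply: eq_bigr => i _.
    have eR : e i *m rho reg x = \sum_l (x ** e l) 0 i *: e l.
      rewrite [LHS](row_sum_delta _); apply: eq_bigr => l _.
      by rewrite /basis_el -rowE mxE R_entry.
    rewrite (eq_bigr (fun l => sw (e i) (fun a b => (x ** e l) 0 i *: kron (E a l) (rho M b))));
      last by move=> l _; rewrite sw_scale.
    rewrite /sweedler [RHS]exchange_big mulmx_suml; apply: eq_bigr => a _.
    rewrite [RHS]exchange_big mulmx_suml; apply: eq_bigr => b _.
    rewrite -scalemxAl kronM mulmx1 -scaler_sumr; congr (_ *: _).
    rewrite /E -mulmxA eR mulmx_sumr; apply/matrixP => r s.
    rewrite kronE [X in X * _]summxE mulr_suml [RHS]summxE; apply: eq_bigr => l _.
    by rewrite -scalemxAr [in RHS]mxE kronE mxE mulrA.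
  rewrite exchange_big; apply: eq_bigr => l _.
  by rewrite [RHS](lin_expand (x ** e l) (lin_sw H _)).
rewrite mulmx_sumr; apply: eq_bigr => l _; rewrite (swM hH _ _ (bF l)).
rewrite rho_tensor /sweedler mulmx_suml; apply: eq_bigr => a _.
rewrite mulmx_suml; apply: eq_bigr => b _.
rewrite -scalemxAl; congr (_ *: _).
rewrite mulmx_sumr; apply: eq_bigr => c _; rewrite mulmx_sumr; apply: eq_bigr => f _.
by rewrite -scalemxAr kronM MM /E mulmxA rho_reg.
Qed.

Lemma trivn_tensor n (M : hmod) : mod_iso (tensor (trivn n.+1) M) (dsum_mod M (tensor (trivn n) M)).
Proof.
have h : mod_iso (trivn n.+1) (dsum_mod (triv_mod H) (trivn n)).
  apply: (mod_iso_bij (f := id : 'I_n.+1 -> 'I_(1 + n)) (g := id)) => // i a b.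
  by rewrite -(scalar_mx_block 1 n).
apply: mod_iso_trans (tensor_iso h (mod_iso_refl M)) _.
apply: mod_iso_trans (tensor_dsum _ _ _) _.
by apply: mod_iso_dsum; [exact: triv_tensor | exact: mod_iso_refl].
Qed.

Lemma free_add m n : mod_iso (free (m + n)) (dsum_mod (free m) (free n)).
Proof.
elim: m => [|m IH]; first by apply: mod_iso_sym; exact: dsum0.
apply: mod_iso_trans (dsum_assoc _ _ _).
by apply: mod_iso_dsum => //; exact: mod_iso_refl.
Qed.

(** [tensor_identity] replaces [M] by a sum of [hdim M] copies of k, each contributing one copy of
    A. *)
Lemma reg_tensor (M : hmod) : is_module H M -> mod_iso (tensor reg M) (free (hdim M)).
Proof.
move=> hM; apply: mod_iso_trans (mod_iso_sym (tensor_identity hM)) _.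
apply: mod_iso_trans (tensorC _ _) _.
elim: (hdim M) => [|n IH].
  by apply: (mod_iso_bij (f := id : 'I_(0 * d) -> 'I_0) (g := id)) => // i [].
apply: mod_iso_trans (trivn_tensor _ _) _.
by apply: mod_iso_dsum => //; exact: mod_iso_refl.
Qed.

Lemma free_tensor m (M : hmod) : is_module H M -> mod_iso (tensor (free m) M) (free (m * hdim M)).
Proof.
move=> hM; elim: m => [|m IH]; first exact: tensor_zero.
apply: mod_iso_trans (tensor_dsum _ _ _) _.
apply: mod_iso_trans (mod_iso_sym (free_add _ _)).
by apply: mod_iso_dsum => //; exact: reg_tensor.
Qed.

Lemma tensor_module (M N : hmod) : is_module H M -> is_module H N -> is_module H (tensor M N).
Proof.
move=> [M1 MM] [N1 NN]; split=> [|x y].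
  by rewrite rho_tensor (sw1 hH (bilin_kron M N)) M1 N1 kron1.
rewrite !rho_tensor (swM hH _ _ (bilin_kron M N)) /sweedler mulmx_suml; apply: eq_bigr => a _.
rewrite mulmx_suml; apply: eq_bigr => b _; rewrite -scalemxAl; congr (_ *: _).
rewrite mulmx_sumr; apply: eq_bigr => c _; rewrite mulmx_sumr; apply: eq_bigr => f _.
by rewrite -scalemxAr kronM MM NN.
Qed.

Lemma rho_dual (M : hmod) x : rho (dual_mod H M) x = (rho M (S x))^T.
Proof.
rewrite (lin_expand x (F := fun x => (rho M (S x))^T)).
  by apply: eq_bigr => i _; rewrite anti_basis.
by move=> c u v; rewrite (lin_anti H) (lin_rho M) linearP.
Qed.

Lemma dual_module (M : hmod) : is_module H M -> is_module H (dual_mod H M).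
Proof.
move=> [M1 MM]; split=> [|x y]; first by rewrite rho_dual (anti1 hH) M1 trmx1.
by rewrite !rho_dual (antiM hH) MM trmx_mul.
Qed.

(* Both summands come from [M (x) M^* (x) L], computed with the two bracketings. *)
Lemma dual_tensor_cancel (hloc : local_alg H) m (M L : hmod) : is_module H M -> is_module H L ->
  hdim L = hdim M ->
  mod_iso (tensor (dual_mod H M) M) (dsum_mod (free m) (triv_mod H)) ->
  mod_iso (tensor (dual_mod H M) L) (dsum_mod (free m) (triv_mod H)) ->
  mod_iso L M.
Proof.
move=> hM hL dLM hMM hML.
have add N : is_module H N ->
    mod_iso (tensor (dsum_mod (free m) (triv_mod H)) N) (dsum_mod (free (m * hdim N)) N).
  move=> hN; apply: mod_iso_trans (tensor_dsum _ _ _) _.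
  by apply: mod_iso_dsum; [exact: free_tensor | exact: triv_tensor].
(* Equality of the dimensions of [L] and [M] gives both sides a free summand of the same rank, as
   cancellation demands. *)
apply: (cancel_free hH hloc (m := m * hdim M)).
apply: mod_iso_trans (add _ hM); rewrite -{1}dLM.
apply: mod_iso_trans (mod_iso_sym (add _ hL)) _.
apply: mod_iso_trans (tensor_iso (mod_iso_sym hMM) (mod_iso_refl L)) _.
apply: mod_iso_trans (tensor_iso (tensorC _ _) (mod_iso_refl L)) _.
apply: mod_iso_trans (mod_iso_sym (tensorA _ _ _)) _.
apply: mod_iso_trans (tensorC _ _) _.
exact: tensor_iso hML (mod_iso_refl M).
Qed.

End Tensor.

(** * Linear algebra behind the finiteness: functionals, determinants, minors *)

Section FiniteSelection.
Variable k : fieldType.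

(* Extending the list of witnesses by one that it does not yet cover increases the
   rank of the span of its functionals, so this stops after at most N steps. *)
Lemma finite_selection (Y : Type) (y0 : Y) N (Phi : Y -> 'cV[k]_N) (W : Y -> 'rV[k]_N -> Prop) :
  exists (r : nat) (g : nat -> Y * 'rV[k]_N),
    (forall j, (j < r)%N -> W (g j).1 (g j).2) /\
    forall z c, W z c -> c *m Phi z != 0 -> exists2 j, (j < r)%N & (g j).2 *m Phi z != 0.
Proof.
(* [q] strictly bounds the codimension of the span of the functionals chosen so far. The search
   starts from the empty list, [y0] being the default value of [g]. *)
suff ext q : forall (r : nat) (g : nat -> Y * 'rV[k]_N),
    (N - \rank (\sum_(j < r) <<(g j).2>>)%MS < q)%N ->
    (forall j, (j < r)%N -> W (g j).1 (g j).2) ->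
  exists (r : nat) (g : nat -> Y * 'rV[k]_N),
    (forall j, (j < r)%N -> W (g j).1 (g j).2) /\
    forall z c, W z c -> c *m Phi z != 0 -> exists2 j, (j < r)%N & (g j).2 *m Phi z != 0.
  by apply: (ext N.+1 0%N (fun _ => (y0, 0))) => //; rewrite ltnS leq_subr.
elim: q => [//|q IH] r g hr hg.
have [cov|ncov] := classic (forall z c, W z c -> c *m Phi z != 0 ->
  exists2 j, (j < r)%N & (g j).2 *m Phi z != 0); first by exists r, g.
have [z [c [Wz cz hz]]] : exists z c, [/\ W z c, c *m Phi z != 0 &
    forall j, (j < r)%N -> (g j).2 *m Phi z = 0].
  apply: NNPP => hn; apply: ncov => z c Wz cz; apply: NNPP => hn'; apply: hn.
  exists z, c; split=> // j jr; apply/eqP; apply: contra_notT hn' => hj; by exists j.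
set U := (\sum_(j < r) <<(g j).2>>)%MS in hr.
(* The whole span [U] annihilates [Phi z], but [c] does not. *)
have cU : ~~ (c <= U)%MS.
  apply: contra cz => cU; rewrite -sub_kermx; apply: submx_trans cU _.
  by apply/sumsmx_subP => j _; rewrite genmxE sub_kermx hz.
apply: (IH r.+1 (fun j => if j == r then (z, c) else g j)) => [|j]; last first.
  by rewrite ltnS leq_eqVlt; case: eqP => //= _; exact: hg.
rewrite big_ord_recr /= eqxx (eq_bigr (fun j : 'I_r => (<<(g j).2>>)%MS)); last first.
  by move=> j _; rewrite ltn_eqF.
have rU : (\rank U < \rank (U + <<c>>)%MS)%N.
  rewrite (ltn_leqif (mxrank_leqif_sup (addsmxSl U (<<c>>)%MS))).
  by apply: contra cU => h; apply: submx_trans h; apply: submx_trans (addsmxSr U _); rewrite genmxE.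
rewrite -ltnS; apply: leq_trans hr; rewrite ltnS; apply: ltn_sub2l => //.
exact: leq_trans rU (rank_leq_col _).
Qed.

(** Leibniz formula with the products of sums distributed. A monomial is indexed by the variable
    [f i] taken from row [i], so the index set depends on [m] and [T] only, not on the coefficients
    [c]. *)
Lemma det_monomial_expansion (T : finType) m (c : 'I_m -> 'I_m -> T -> k) :
  exists C : {ffun 'I_m -> T} -> k, forall x : T -> k,
    \det (\matrix_(i, j) \sum_t c i j t * x t) = \sum_f C f * \prod_i x (f i).
Proof.
exists (fun f => \sum_(s : 'S_m) (-1) ^+ s * \prod_i c i (s i) (f i)) => x.
rewrite /determinant.
transitivity (\sum_(s : 'S_m) \sum_(f : {ffun 'I_m -> T})
    ((-1) ^+ s * \prod_i c i (s i) (f i)) * \prod_i x (f i)).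
  apply: eq_bigr => s _; rewrite (eq_bigr (fun i => \sum_t c i (s i) t * x t)).
    rewrite bigA_distr_bigA mulr_sumr; apply: eq_bigr => f _.
    by rewrite big_split mulrA.
  by move=> i _; rewrite mxE.
by rewrite exchange_big; apply: eq_bigr => f _; rewrite mulr_suml.
Qed.

(** A generalized minor: compression by [P] and [Q] replaces the selection of rows and columns. The
    determinant of the compression is still polynomial in the matrix, and its nonvanishing still
    bounds the rank from below. *)
Lemma rank_minor N m (X : 'M[k]_N) : (m <= \rank X)%N ->
  exists (P : 'M_(m, N)) (Q : 'M_(N, m)), P *m X *m Q = 1%:M.
Proof.
move=> hm; have hN := leq_trans hm (rank_leq_col X).
exists (pid_mx m *m invmx (col_ebase X)), (invmx (row_ebase X) *m pid_mx m).
rewrite -{2}(mulmx_ebase X) !mulmxA mulmxKV ?col_ebase_unit // mulmxK ?row_ebase_unit //.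
rewrite !mul_pid_mx -[RHS]pid_mx_1; congr pid_mx.
by rewrite (minn_idPl hm) (minn_idPr hN) minnn (minn_idPr hN).
Qed.

End FiniteSelection.

(** * The rank criterion for isomorphism with an endotrivial module *)

Section Criterion.
Variables (k : fieldType) (d : nat) (H : hopf_data k d).
Hypotheses (hH : is_cocomm_hopf H) (hloc : local_alg H).
Variables (s : 'rV[k]_d) (lam : 'cV[k]_d).
Hypotheses (s_eps : forall u, mulH H s u = counitH H u *: s)
  (slam : s *m lam = 1%:M) (lamU : gram H lam \in unitmx).
Local Notation hmod := (hmod k d).

Definition dual_rank (M L : hmod) : nat := \rank (rho (tensor_mod H (dual_mod H M) L) s).

Lemma dual_tensor_split m (M L : hmod) : is_module H M -> is_module H L ->
  (hdim M * hdim L = (m * d).+1)%N -> (m <= dual_rank M L)%N ->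
  mod_iso (tensor_mod H (dual_mod H M) L) (dsum_mod (free_mod H m) (triv_mod H)).
Proof.
move=> hM hL dim hm; have hD := tensor_module hH (dual_module hH hM) hL.
have [X hX] := split_free hH hloc s_eps slam lamU hD hm.
apply: (mod_iso_trans hX); apply: mod_iso_dsum; first exact: mod_iso_refl.
have [_ mX] := (dsum_module H (free_mod H m) X).1 (mod_iso_module hX hD).
apply: dim1_triv => //; have := mod_iso_dim hX; rewrite /= hdim_free dim -addn1.
by move/addnI.
Qed.

(** On the projective summand [P] the rank of [s] is [hdim P] divided by [d]; the [.-1] removes the
    dimension of the trivial summand. *)
Lemma endotrivial_rank (M : hmod) : endotrivial H M ->
  let m := ((hdim M * hdim M).-1 %/ d)%N in
  (hdim M * hdim M = (m * d).+1)%N /\ (m <= dual_rank M M)%N.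
Proof.
move=> [hM [P [hP hiso]]] m.
have rP := projective_rank hH hloc s_eps slam lamU hP.
have dim : (hdim M * hdim M = (hdim P).+1)%N by have := mod_iso_dim hiso.
have -> : m = \rank (rho P s).
  by rewrite /m dim /= -[X in (X %/ d)%N]rP mulnK // (hopf_dim_gt0 hH).
split; first by rewrite rP.
by rewrite /dual_rank (mod_iso_rank s hiso) rank_dsum leq_addl.
Qed.

Lemma dual_rank_iso m (M L : hmod) : is_module H M -> is_module H L -> hdim L = hdim M ->
  (hdim M * hdim M = (m * d).+1)%N -> (m <= dual_rank M M)%N -> (m <= dual_rank M L)%N ->
  mod_iso L M.
Proof.
move=> hM hL dLM dim hMM hML; apply: (dual_tensor_cancel hH hloc (m := m)) => //.
  exact: dual_tensor_split.
by apply: dual_tensor_split; rewrite ?dLM.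
Qed.

(* For fixed M, P, Q the minor is a homogeneous polynomial of degree m in the matrix
   entries of the action on L, hence a combination of a fixed finite set of monomials. *)
Lemma dual_rank_minor n m (M : hmod) (P : 'M[k]_(m, hdim M * n)) (Q : 'M[k]_(hdim M * n, m)) :
  exists C : {ffun 'I_m -> 'I_d * ('I_(hdim M * n) * 'I_(hdim M * n))} -> k,
    forall b : 'I_d -> 'M[k]_n,
    \det (P *m rho (tensor_mod H (dual_mod H M) (HMod b)) s *m Q) =
    \sum_f C f * \prod_i b (f i).1 (unidx (f i).2.1).2 (unidx (f i).2.2).2.
Proof.
(* [s] acts on the tensor product as the sum of the [kron (D l) (b l)]: [D] collects the
   contribution of [M], and the sum is linear in [b]. *)
pose D l : 'M[k]_(hdim M) := \sum_j comulH H s j l *: hact (dual_mod H M) j.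
pose c i j (t : 'I_d * ('I_(hdim M * n) * 'I_(hdim M * n))) : k :=
  P i t.2.1 * D t.1 (unidx t.2.1).1 (unidx t.2.2).1 * Q t.2.2 j.
have [C hC] := det_monomial_expansion c.
exists C => b; rewrite -(hC (fun t => b t.1 (unidx t.2.1).2 (unidx t.2.2).2)); congr (\det _).
have -> : rho (tensor_mod H (dual_mod H M) (HMod b)) s = \sum_l kron (D l) (b l).
  rewrite rho_tensor /sweedler exchange_big; apply: eq_bigr => l _.
  apply/matrixP => r t; rewrite kronE summxE [X in _ = X * _]summxE mulr_suml.
  by apply: eq_bigr => j _; rewrite !rho_basis mxE kronE [in RHS]mxE mulrA.
apply/matrixP => i j; rewrite mulmx_sumr mulmx_suml summxE [RHS]mxE.
rewrite [RHS](eq_bigr (fun t => c i j (t.1, t.2) * b t.1 (unidx t.2.1).2 (unidx t.2.2).2));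
  last by case.
rewrite -(pair_bigA _ (fun l t => c i j (l, t) * b l (unidx t.1).2 (unidx t.2).2)) /=.
apply: eq_bigr => l _.
rewrite [RHS](eq_bigr (fun t => c i j (l, (t.1, t.2)) * b l (unidx t.1).2 (unidx t.2).2));
  last by case.
rewrite -(pair_bigA _ (fun u v => c i j (l, (u, v)) * b l (unidx u).2 (unidx v).2)) /=.
rewrite exchange_big mxE; apply: eq_bigr => v _; rewrite mxE mulr_suml; apply: eq_bigr => u _.
by rewrite kronE /c /= mulrA [LHS]mulrAC.
Qed.

End Criterion.

Theorem theorem3p5 (k : closedFieldType) (p : nat) (hp : prime p)
  (hchar : p \in [pchar k]) (d : nat) (H : hopf_data k d)
  (hH : is_cocomm_hopf H) (hunip : local_alg H) (n : nat) (hn : (0 < n)%N) :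
  exists (r : nat) (f : nat -> hmod k d),
    forall M : hmod k d, hdim M = n -> endotrivial H M ->
      exists2 j, (j < r)%N & mod_iso M (f j).
Proof.
have [s [lam [_ s_eps slam lamU]]] := frobenius_form hH hunip.
pose m := ((n * n).-1 %/ d)%N.
(* A variable is a basis index of A with a row and a column of the tensor space, from which [unidx]
   extracts those of the second factor. *)
pose T := ('I_d * ('I_(n * n) * 'I_(n * n)))%type; pose N := #|{: {ffun 'I_m -> T}}|.
pose mono (q : 'I_N) : {ffun 'I_m -> T} := enum_val q.
pose Y := 'I_d -> 'M[k]_n.
pose Phi (b : Y) : 'cV[k]_N :=
  \col_q \prod_i b (mono q i).1 (unidx (mono q i).2.1).2 (unidx (mono q i).2.2).2.
(* [c] is a certificate for [a]: wherever it does not vanish, the rank hypothesis of [dual_rank_iso]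
   holds. *)
pose W (a : Y) (c : 'rV[k]_N) := endotrivial H (HMod a) /\
  forall b : Y, c *m Phi b != 0 -> (m <= dual_rank H s (HMod a) (HMod b))%N.
have [r [g [gW gcov]]] := finite_selection (fun _ => 0 : 'M[k]_n) Phi W.
exists r, (fun j => HMod (g j).1) => M; case: M => n' a /= eqn; subst n' => aE.
have [dim rk] := endotrivial_rank hH hunip s_eps slam lamU aE.
have [P [Q PQ]] := rank_minor rk.
have [C hC] := dual_rank_minor H s (M := HMod a) (n := n) P Q.
pose c : 'rV[k]_N := \row_q C (mono q).
have cE b : c *m Phi b =
    (\det (P *m rho (tensor_mod H (dual_mod H (HMod a)) (HMod b)) s *m Q))%:M.
  apply/matrixP => i j; rewrite hC !ord1 !mxE eqxx mulr1n.
  rewrite [RHS](reindex _ (onW_bij _ (@enum_val_bij {ffun 'I_m -> T}))) /=.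
  by apply: eq_bigr => q _; rewrite !mxE.
have Wa : W a c.
  split=> // b; rewrite cE => h.
  have dn : \det (P *m rho (tensor_mod H (dual_mod H (HMod a)) (HMod b)) s *m Q) != 0.
    by apply: contraNneq h => ->; rewrite raddf0.
  rewrite /dual_rank.
  have <- : \rank (P *m rho (tensor_mod H (dual_mod H (HMod a)) (HMod b)) s *m Q) = m.
    by apply: mxrank_unit; rewrite unitmxE unitfE.
  by apply: leq_trans (mxrankM_maxl _ _) _; exact: mxrankM_maxr.
(* At [a] itself the compressed matrix is the identity, so the certificate does not vanish there. *)
have [|j jr hj] := gcov a c Wa.
  rewrite cE PQ det1; apply/eqP => /matrixP/(_ 0 0); rewrite !mxE eqxx => /eqP.
  by rewrite oner_eq0.
exists j => //; have [gE gr] := gW j jr.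
have [dim' rk'] := endotrivial_rank hH hunip s_eps slam lamU gE.
(* The selected module plays the part of [M] in the criterion, the given one that of [L]. *)
apply: (dual_rank_iso hH hunip s_eps slam lamU (m := m)) => //.
- by case: gE.
- by case: aE.
exact: gr.
Qed.
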